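(* Let $G$ be a connected finite graph with adjacency matrix $A$, and suppose $G$ has an equitable partition with one part equal to $\{u,v\}$ (with $u\neq v$) and another part equal to $\{w\}$. Then, by adding suitable potentials at $u$, $v$ and $w$, one can guarantee PGST between $u$ and $v$; that is, there exist real numbers $q_u,q_v,q_w$ such that the matrix $A+D$ has PGST between $u$ and $v$, where $D$ is the diagonal matrix with entries $q_u,q_v,q_w$ in positions $u,v,w$ and zeros elsewhere.
   Context: An equitable partition of $G$ is a partition $\{P_1,\dots,P_k\}$ of $V(G)$ such that for all $i,j$ and any $v_1,v_2\in P_i$ one has $\sum_{x\in P_j}A(v_1,x)=\sum_{x\in P_j}A(v_2,x)$. Adding a potential $q$ at a vertex $x$ means adding $q$ to the diagonal entry of $A$ at $x$. A real symmetric matrix $N$ has PGST (pretty good state transfer) between $u$ and $v$ if $\limsup_{t\to\infty}|(e^{itN})(u,v)|=1$. *)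

(* Defs.v *)
From HB Require Import structures.
From mathcomp Require Import all_boot all_order all_algebra.
From mathcomp Require Import complex.
From mathcomp Require Import all_classical all_reals all_analysis.

Set Implicit Arguments.
Unset Strict Implicit.
Unset Printing Implicit Defensive.

Import Order.TTheory GRing.Theory Num.Theory numFieldNormedType.Exports.

Local Open Scope ring_scope.

Section Graph.
Variables (T : finType) (e : rel T).

Definition simple_graph : Prop := symmetric e /\ irreflexive e.

Definition connected_graph : Prop := forall x y : T, connect e x y.

End Graph.

Section Matrices.
Variables (R : realType) (n : nat).

Definition adjacency (e : rel 'I_n) : 'M[R]_n := \matrix_(i, j) (e i j)%:R.

Definition equitable_partition (A : 'M[R]_n) (P : {set {set 'I_n}}) : Prop :=
  finset.partition P [set: 'I_n] /\
  forall X Y : {set 'I_n}, X \in P -> Y \in P ->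
  forall v1 v2 : 'I_n, v1 \in X -> v2 \in X ->
    \sum_(x in Y) A v1 x = \sum_(x in Y) A v2 x.

Definition potential (q : R) (x : 'I_n) : 'M[R]_n := q *: delta_mx x x.

(* The exponential series, summed entrywise in C; the regular-module copy
   R[i]^o is what carries the topology of the modulus. *)
Definition expmx (M : 'M[R[i]]_n) : 'M[R[i]]_n :=
  \matrix_(i, j)
    (limn (series (fun k => (k`!%:R)^-1 * (M ^+ k) i j : R[i]^o)) : R[i]).

Definition evolution (N : 'M[R]_n) (t : R) : 'M[R[i]]_n :=
  expmx ('i%C *: map_mx (real_complex R) (t *: N)).

(* The modulus in R[i] is itself an element of R[i]; Re turns it into a real. *)
Definition pgst (N : 'M[R]_n) (u v : 'I_n) : Prop :=
  limf_esup (fun t : R => (complex.Re `|evolution N t u v|)%:E)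
            (pinfty_nbhs R) = 1%:E.

End Matrices.

(* Main.v *)
Require Import Defs.
From HB Require Import structures.
From mathcomp Require Import all_boot all_order all_algebra.
From mathcomp Require Import complex.
From mathcomp Require Import all_classical all_reals all_analysis.
From mathcomp Require Import ring lra.

(** Put [q_u = q_v = x] and [q_w = y].  The partition makes [s = e_u + e_v] and
    [d = e_u - e_v] generate orthogonal invariant subspaces, and
    [4 (e^{itN})(u, v)] is the difference of the Fourier transforms of the
    spectral measures of [N] at [s] and at [d].  By an argument of Bohr this has
    modulus arbitrarily close to its maximum [4] at arbitrarily large times,
    provided that two families of [p] nodes with equal sums always contain the
    same number of nodes of the measure at [d].

    The nodes are roots of polynomials [F - x G], where [F] and [G] come from
    the measures at [x = 0].  For all but countably many [x] a polynomial
    relation [C(x, r) = 0] holds at every root [r] or at none, because it says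
    that [C(F/G, Z)] vanishes at [r].  Hence, in any fixed additive relation, the
    number of solutions having a prescribed root in a prescribed slot does not
    depend on that root, so averaging over all solutions replaces each root by
    the mean of the roots.  As the means for [s] and [d] differ once [y] is
    large, the number of [d]-nodes on both sides must agree. *)

Set Implicit Arguments.
Unset Strict Implicit.
Unset Printing Implicit Defensive.

Import Order.TTheory GRing.Theory Num.Theory numFieldNormedType.Exports.

Local Open Scope ring_scope.
Local Open Scope complex_scope.

(** * Zero-sum tuples of roots *)

Section RootTuples.
Variables (W : numClosedFieldType) (K : Type).
Implicit Types (rs : K -> seq W) (ks : seq K).

(** A kind [k] carries the root list [rs k], and [ks] prescribes a kind for each slot. Repetitions
    are kept, so that all counts are with multiplicity. *)
Fixpoint tuples rs ks : seq (seq W) :=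
  if ks is k :: ks' then [seq r :: l | r <- rs k, l <- tuples rs ks']
  else [:: [::]].

Definition sums rs ks : seq W := [seq \sum_(r <- l) r | l <- tuples rs ks].

Lemma size_tuples rs ks l : l \in tuples rs ks -> size l = size ks.
Proof.
elim: ks l => [|k ks IH] l /=; first by rewrite inE => /eqP ->.
by case/allpairsP => -[r l'] /= [_ /IH <- ->].
Qed.

Lemma big_tuples_cons (V : nmodType) rs k ks (f : seq W -> V) :
  \sum_(l <- tuples rs (k :: ks)) f l =
  \sum_(r <- rs k) \sum_(l <- tuples rs ks) f (r :: l).
Proof. by rewrite /= big_allpairs_dep. Qed.

Lemma big_tuples_cat (V : nmodType) rs ks1 ks2 (f : seq W -> V) :
  \sum_(l <- tuples rs (ks1 ++ ks2)) f l =
  \sum_(l1 <- tuples rs ks1) \sum_(l2 <- tuples rs ks2) f (l1 ++ l2).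
Proof.
elim: ks1 f => [|k ks1 IH] f; first by rewrite /= big_seq1.
rewrite cat_cons !big_tuples_cons; apply: eq_bigr => r _.
by rewrite IH.
Qed.

Lemma count_sums rs ks c :
  (count_mem c (sums rs ks))%:R =
  \sum_(l <- tuples rs ks) (\sum_(r <- l) r == c)%:R :> W.
Proof.
rewrite /sums count_map -sum1_count natr_sum big_mkcond /=.
by apply: eq_bigr => l _; case: ifP.
Qed.

(** Once [r] is placed in the slot of [k], the tuple sums to zero exactly when the remaining slots
    sum to [- r]. *)
Lemma marginal_sum rs ks1 k ks2 (g : W -> W) :
  \sum_(l <- tuples rs (ks1 ++ k :: ks2))
     (\sum_(r <- l) r == 0)%:R * g (nth 0 l (size ks1)) =
  \sum_(r <- rs k) g r * (count_mem (- r) (sums rs (ks1 ++ ks2)))%:R.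
Proof.
rewrite big_tuples_cat.
under eq_big_seq => l1 /size_tuples Hl1.
  rewrite big_tuples_cons.
  under eq_bigr => r _ do under eq_bigr => l2 _ do
    rewrite -Hl1 nth_cat ltnn subnn /= big_cat big_cons /= addrCA addrC
      addr_eq0.
  over.
rewrite exchange_big /=; apply: eq_bigr => r _.
rewrite count_sums big_tuples_cat mulr_sumr; apply: eq_bigr => l1 _.
rewrite mulr_sumr; apply: eq_bigr => l2 _.
by rewrite mulrC big_cat.
Qed.

Lemma mem_tuples rs ks l :
  all2 (fun k r => r \in rs k) ks l -> l \in tuples rs ks.
Proof.
elim: ks l => [|k ks IH] [|r l] //= /andP[rk /IH Hl].
by apply/allpairsP; exists (r, l).
Qed.

(* If every marginal of the uniform measure on the zero-sum tuples is uniform,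
   the slot averages add up to zero as soon as one zero-sum tuple exists. *)
Lemma zero_sum_averages rs ks z :
  (forall k, (0 < size (rs k))%N) ->
  (forall ks1 k ks2, ks = ks1 ++ k :: ks2 -> {in rs k &, forall r r',
     count_mem (- r) (sums rs (ks1 ++ ks2)) =
     count_mem (- r') (sums rs (ks1 ++ ks2))}) ->
  all2 (fun k r => r \in rs k) ks z -> \sum_(r <- z) r = 0 ->
  \sum_(k <- ks) (\sum_(r <- rs k) r) / (size (rs k))%:R = 0.
Proof.
move=> rs_gt0 unif /mem_tuples z_in z0.
(* The number of zero-sum tuples, nonzero because [z] is one of them. *)
pose V := \sum_(l <- tuples rs ks) (\sum_(r <- l) r == 0)%:R : W.
have V_neq0 : V != 0.
  rewrite /V -count_sums pnatr_eq0 -lt0n -has_count has_pred1.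
  by apply/mapP; exists z; rewrite ?z0.
case Dks: ks => [|k0 ks']; first by rewrite big_nil.
rewrite -Dks; apply: (mulfI V_neq0); rewrite mulr0 mulr_sumr.
(* Both sides are compared with the sum of all entries of all zero-sum tuples, taken slot by slot;
   taken tuple by tuple it is 0. *)
transitivity (\sum_(j < size ks) \sum_(l <- tuples rs ks)
     (\sum_(r <- l) r == 0)%:R * nth 0 l j); last first.
  rewrite exchange_big /= big_seq big1 // => l /size_tuples Hl.
  rewrite -mulr_sumr; have [l0|] := eqVneq; last by rewrite mul0r.
  by rewrite mul1r -Hl -[RHS]l0 [RHS](big_nth 0) big_mkord.
rewrite (big_nth k0) big_mkord; apply: eq_bigr => j _.
have Eks : ks = take j ks ++ nth k0 ks j :: drop j.+1 ks.
  by rewrite -drop_nth // cat_take_drop.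
have Ej : size (take j ks) = j by rewrite size_take ltn_ord.
move: (nth _ _ _) (take _ _) (drop _ _) Eks Ej => k ks1 ks2 Eks Ej.
have [r0 r0k] : exists r, r \in rs k.
  by case: (rs k) (rs_gt0 k) => // r ? _; exists r; rewrite mem_head.
pose n := count_mem (- r0) (sums rs (ks1 ++ ks2)).
have marg (g : W -> W) : \sum_(l <- tuples rs ks)
     (\sum_(r <- l) r == 0)%:R * g (nth 0 l j) = (\sum_(r <- rs k) g r) * n%:R.
  rewrite -Ej Eks marginal_sum mulr_suml; apply: eq_big_seq => r rk.
  by rewrite (unif _ _ _ Eks r r0).
have sum1r : \sum_(r <- rs k) 1 = (size (rs k))%:R :> W.
  by rewrite -sum1_size natr_sum.
(* With [g = 1] the marginal gives [V = size (rs k) * n], with [g = id] it gives the total in slot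
   [j]; their quotient is the mean of [rs k]. *)
have := marg (fun=> 1); rewrite /= sum1r.
under eq_bigr do rewrite mulr1; rewrite -/V => ->.
have -> := marg id; have sz0 : (size (rs k))%:R != 0 :> W.
  by rewrite pnatr_eq0 -lt0n.
by field.
Qed.

End RootTuples.

(** * Generic additive relations between roots *)

Lemma det_char_poly_mx_sub (R : comNzRingType) n (M : 'M[R]_n) (s : R) :
  \det (char_poly_mx M - s%:P%:M) = char_poly M \Po ('X - s%:P).
Proof.
rewrite /char_poly -det_map_mx; congr (\det _).
apply/matrixP => i j; rewrite !mxE.
by rewrite rmorphB /= comp_polyC rmorphMn /= comp_polyX mulrnBl addrAC.
Qed.

(* The determinant of H(X - M), with M a companion matrix of p, specializes
   to the product of H(X - r) over the roots r of p. *)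
Lemma root_sums_poly (A : comNzRingType) (p H : {poly A}) :
  p \is monic -> (1 < size p)%N ->
  exists H' : {poly A}, forall (W : fieldType) (f : {rmorphism A -> W}) rr ss,
    map_poly f p = \prod_(r <- rr) ('X - r%:P) ->
    map_poly f H = \prod_(s <- ss) ('X - s%:P) ->
    map_poly f H' = \prod_(r <- rr) \prod_(s <- ss) ('X - (r + s)%:P).
Proof.
move=> p_mon p_gt1.
have [d [M Mp]] : exists d (M : 'M[A]_d.+1), char_poly M = p.
  have := companionmxK p_mon; move: (companionmx p).
  by case: (size p) p_gt1 => [|[|d]] //= _ M Mp; exists d, M.
exists (\det (horner_mx (char_poly_mx M) (map_poly polyC H))).
move=> W f rr ss Ep EH.
rewrite -det_map_mx map_horner_mx map_char_poly_mx -map_poly_comp.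
rewrite (eq_map_poly (g := polyC \o f)); last by move=> a /=; rewrite map_polyC.
rewrite map_poly_comp EH rmorph_prod.
under eq_bigr do rewrite rmorphB /= map_polyX map_polyC.
(* The matrix is now the product of the [X - M - s]; each factor has as determinant the
   characteristic polynomial of [M] at [X - s]. *)
rewrite rmorph_prod /=; elim: ss {EH} => [|s ss IH].
  by rewrite big_nil det1 big1 // => r _; rewrite big_nil.
rewrite big_cons det_mulmx IH.
under [RHS]eq_bigr do rewrite big_cons.
rewrite big_split /=; congr (_ * _).
rewrite rmorphB /= horner_mx_X horner_mx_C det_char_poly_mx_sub.
rewrite -map_char_poly Mp Ep rmorph_prod; apply: eq_bigr => r _.
by rewrite rmorphB /= comp_polyX comp_polyC polyCD opprD addrA addrAC.
Qed.

(* Homogenizing C in its inner variable at F/G gives a univariate polynomial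
   which decides C along the curve F = x G. *)
Lemma generic_zero (W : closedFieldType) (F G : {poly W})
    (C : {poly {poly W}}) :
  F != 0 -> (forall z, root F z -> ~~ root G z) ->
  exists2 E : {poly W}, E != 0 & forall x, ~~ root E x ->
    forall z z', root (F - x *: G) z -> root (F - x *: G) z' ->
    (map_poly (horner_eval x) C).[z] = 0 ->
    (map_poly (horner_eval x) C).[z'] = 0.
Proof.
move=> F0 cop; pose d := \max_(b < size C) size (C`_b)%R.
(* [D] is [G^d * C(F/G, X)], where [d] bounds the degree of [C] in its inner variable. *)
pose D := \sum_(b < size C) \sum_(a < d)
  (C`_b`_a)%:P * F ^+ a * G ^+ (d - a) * 'X^b.
have onE x z : root (F - x *: G) z -> F.[z] = x * G.[z].
  by rewrite /root !hornerE subr_eq0 => /eqP.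
have DE x z : root (F - x *: G) z ->
    D.[z] = G.[z] ^+ d * (map_poly (horner_eval x) C).[z].
  move=> /onE Fz; rewrite /D horner_sum.
  rewrite [X in _ * X](horner_coef_wide z (n := size C)) ?size_poly //.
  rewrite mulr_sumr; apply: eq_bigr => b _; rewrite horner_sum coef_map /=.
  rewrite /horner_eval (horner_coef_wide x (n := d)); last first.
    exact: (@leq_bigmax _ (fun b : 'I_(size C) => size C`_b) b).
  rewrite mulr_suml mulr_sumr; apply: eq_bigr => a _.
  have -> : G.[z] ^+ d = G.[z] ^+ (d - a) * G.[z] ^+ a.
    by rewrite -exprD subnK // ltnW.
  by rewrite !hornerE /= Fz exprMn; ring.
have G_neq0 x z : root (F - x *: G) z -> G.[z] != 0.
  move=> /onE Fz; apply/negP => /eqP Gz.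
  have /cop : root F z by rewrite /root Fz Gz mulr0.
  by rewrite /root Gz eqxx.
(* If [D = 0], the relation holds at every root for every [x]; otherwise it can hold only at the
   finitely many roots of [D]. *)
have [D0|D0] := eqVneq D 0.
  exists 1; rewrite ?oner_neq0 // => x _ z z' _ rz' _.
  apply: (mulfI (expf_neq0 d (G_neq0 _ _ rz'))).
  by rewrite -DE // D0 horner0 mulr0.
have [rs rsE] := closed_field_poly_normal D.
(* A root [z] of [D] lies on the curve [F = x G] only for [x = F(z)/G(z)]. Where [G] vanishes,
   division by zero merely adds the exceptional value 0. *)
exists (\prod_(y <- [seq F.[z] / G.[z] | z <- rs]) ('X - y%:P)).
  exact/monic_neq0/monic_prod_XsubC.
move=> x nx z z' rz _ Cz; case/negP: nx.
have : root D z by rewrite /root (DE _ _ rz) Cz mulr0.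
rewrite rsE rootZ ?lead_coef_eq0 // root_prod_XsubC => zrs.
rewrite root_prod_XsubC; apply/mapP; exists z => //.
by rewrite (onE _ _ rz) mulfK // (G_neq0 _ _ rz).
Qed.

Lemma coef_comp_polyXD (R : comNzRingType) (p : {poly R}) (a : R) i :
  (p \Po ('X + a%:P))`_i = p^`N(i).[a].
Proof.
rewrite addrC /comp_poly nderiv_taylor; last exact: mulrC.
rewrite size_map_polyC.
under eq_bigr do rewrite nderivn_map horner_map mul_polyC.
rewrite -(poly_def (size p) (fun j => p^`N(j).[a])) coef_poly.
case: ltnP => // le_pi.
by rewrite nderivn_poly0 // horner0.
Qed.

(** Exceptional sets are recorded as roots of nonzero polynomials, so finitely many of them are
    merged by a product. *)
Lemma generic_ltn (W : idomainType) (P : nat -> W -> Prop) :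
  (forall i, exists2 E : {poly W}, E != 0 & forall x, ~~ root E x -> P i x) ->
  forall n, exists2 E : {poly W}, E != 0 &
    forall x, ~~ root E x -> forall i, (i < n)%N -> P i x.
Proof.
move=> genP; elim=> [|n [E E0 EP]]; first by exists 1; rewrite ?oner_neq0.
have [E' E'0 E'P] := genP n; exists (E * E'); first exact: mulf_neq0.
move=> x; rewrite rootM negb_or => /andP[xE xE'] i.
by rewrite ltnS leq_eqVlt => /predU1P[->|]; [exact: E'P | exact: EP].
Qed.

(** A multiplicity is the number of initial Taylor coefficients that vanish. This turns the
    comparison of counts into vanishing conditions, to which [generic_zero] applies. *)
Lemma count_mem_eq_nderivn (W : fieldType) (ss : seq W) c c' :
  (forall i, (\prod_(s <- ss) ('X - s%:P))^`N(i).[c] = 0 <->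
             (\prod_(s <- ss) ('X - s%:P))^`N(i).[c'] = 0) ->
  count_mem c ss = count_mem c' ss.
Proof.
set H := \prod_(s <- ss) _ => Hcc'.
have first a i :
    (i <= count_mem a ss)%N <-> forall j, (j < i)%N -> H^`N(j).[a] = 0.
  have [Q Q0 HQ] : exists2 Q : {poly W}, Q`_0 != 0 &
      H \Po ('X + a%:P) = Q * 'X^(count_mem a ss).
    rewrite /H rmorph_prod; elim: (ss) => [|s t [Q Q0 HQ]].
      by exists 1; rewrite ?big_nil ?mulr1 // coefC oner_neq0.
    rewrite big_cons HQ rmorphB /= comp_polyX comp_polyC.
    have [->|neq_sa] /= := eqVneq s a.
      by exists Q; rewrite // addrK exprD expr1; ring.
    exists (('X + a%:P - s%:P) * Q); last by rewrite add0n mulrA.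
    rewrite -!horner_coef0 in Q0 *.
    by rewrite !hornerE mulf_neq0 // subr_eq0 eq_sym.
  split=> [le_i j lt_ji|van].
    by rewrite -coef_comp_polyXD HQ coefMXn (leq_trans lt_ji le_i).
  rewrite leqNgt; apply/negP => /van; rewrite -coef_comp_polyXD HQ.
  by rewrite coefMXn ltnn subnn => /eqP; rewrite (negPf Q0).
apply/eqP; rewrite eqn_leq; apply/andP; split; apply/first => j jlt;
  apply/Hcc'; exact: (proj1 (first _ _)) (leqnn _) _ jlt.
Qed.

Section GenericSums.
Variables (W : numClosedFieldType) (K : Type) (F G : K -> {poly W}).
Hypothesis Fmon : forall k, F k \is monic.
Hypothesis sizeF : forall k, (1 < size (F k))%N.
Hypothesis sizeG : forall k, (size (G k) < size (F k))%N.
Hypothesis cop : forall k z, root (F k) z -> ~~ root (G k) z.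

(** The inner variable of [H] stands for [x]: the polynomial whose roots are the sums depends
    polynomially on [x]. Slots are adjoined one at a time by [root_sums_poly]. *)
Lemma sums_poly ks : exists H : {poly {poly W}}, forall x rs,
  (forall k, F k - x *: G k = \prod_(r <- rs k) ('X - r%:P)) ->
  map_poly (horner_eval x) H = \prod_(c <- sums rs ks) ('X - c%:P).
Proof.
elim: ks => [|k ks [H EH]].
  exists 'X => x rs _; rewrite map_polyX /sums /= big_seq1 big_nil.
  by rewrite subr0.
pose p := map_poly polyC (F k) - 'X *: map_poly polyC (G k).
have sp : size p = size (F k).
  rewrite size_polyDl size_map_polyC // size_polyN.
  by apply: leq_ltn_trans (size_scale_leq _ _) _; rewrite size_map_polyC.
have p_mon : p \is monic.
  rewrite monicE lead_coefDl ?lead_coef_map_inj //.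
  - by rewrite (monicP (Fmon k)).
  - exact: polyC_inj.
  rewrite size_polyN size_map_polyC.
  by apply: leq_ltn_trans (size_scale_leq _ _) _; rewrite size_map_polyC.
have [|H' EH'] := @root_sums_poly _ p H p_mon; first by rewrite sp.
exists H' => x rs Ers; rewrite (EH' _ _ (rs k) (sums rs ks)); first last.
- exact: EH.
- have evalC (q : {poly W}) : map_poly (horner_eval x) (map_poly polyC q) = q.
    by apply/polyP => i; rewrite !coef_map /= /horner_eval hornerC.
  by rewrite -Ers rmorphB /= map_polyZ /= !evalC /horner_eval hornerX.
rewrite /sums /= big_map big_allpairs_dep.
apply: eq_bigr => r _; rewrite big_map; apply: eq_bigr => l _.
by rewrite big_cons.
Qed.

Let roots_at x k := sval (closed_field_poly_normal (F k - x *: G k)).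

Let size_FG x k : (size (x *: G k) < size (F k))%N.
Proof. exact: leq_ltn_trans (size_scale_leq _ _) (sizeG k). Qed.

Let roots_atE x k : F k - x *: G k = \prod_(r <- roots_at x k) ('X - r%:P).
Proof.
rewrite /roots_at; case: closed_field_poly_normal => rs /= {1}->.
by rewrite lead_coefDl ?size_polyN // (monicP (Fmon k)) scale1r.
Qed.

Let size_roots_at x k : size (roots_at x k) = (size (F k)).-1.
Proof.
have := congr1 (fun p : {poly W} => size p) (roots_atE x k).
by rewrite size_prod_XsubC size_polyDl ?size_polyN // => ->.
Qed.

(** Vieta's formula for the mean of the roots of the monic polynomial [F k - x *: G k], which can be
    computed without knowing the roots. *)
Definition mean_root x k : W :=
  - (F k - x *: G k)`_(size (F k)).-2 / (size (F k)).-1%:R.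

(** The multiplicity of [- r] among the sums is decided by which divided derivatives of [H] vanish
    at [- r], and each of these is a polynomial relation between [x] and [r]. *)
Lemma uniform_marginal ks k : exists2 E : {poly W}, E != 0 &
  forall x, ~~ root E x -> {in roots_at x k &, forall r r',
    count_mem (- r) (sums (roots_at x) ks) =
    count_mem (- r') (sums (roots_at x) ks)}.
Proof.
have [H EH] := sums_poly ks.
have [E E0 EE] := generic_ltn
  (fun i => generic_zero (H^`N(i) \Po - 'X) (monic_neq0 (Fmon k)) (@cop k))
  (size H).
exists E => // x nE r r' rk r'k.
have rE z : z \in roots_at x k -> root (F k - x *: G k) z.
  by rewrite roots_atE root_prod_XsubC.
apply: count_mem_eq_nderivn => i.
rewrite -(EH x (roots_at x)); last exact: roots_atE.
(* Derivatives of order at least [size H] vanish identically, so finitely many conditions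
   suffice. *)
have [le_Hi|lt_iH] := leqP (size H) i.
  by rewrite nderivn_map nderivn_poly0 // rmorph0 !horner0.
have compE z : (map_poly (horner_eval x) (H^`N(i) \Po - 'X)).[z] =
    (map_poly (horner_eval x) H)^`N(i).[- z].
  rewrite nderivn_map map_comp_poly rmorphN /= map_polyX.
  by rewrite horner_comp !hornerE.
by split; rewrite -!compE; apply: (EE x nE) => //; exact: rE.
Qed.

Lemma mean_rootE x k :
  mean_root x k = (\sum_(r <- roots_at x k) r) / (size (roots_at x k))%:R.
Proof.
rewrite /mean_root size_roots_at; congr (_ / _).
rewrite roots_atE -(size_roots_at x) coefPn_prod_XsubC ?opprK //.
by rewrite size_roots_at -lt0n -subn1 subn_gt0.
Qed.

Lemma generic_zero_sum ks : exists2 E : {poly W}, E != 0 &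
  forall x, ~~ root E x -> forall zs,
    all2 (fun k z => root (F k - x *: G k) z) ks zs ->
    \sum_(z <- zs) z = 0 -> \sum_(k <- ks) mean_root x k = 0.
Proof.
case Dks: ks => [|k0 ks'].
  by exists 1; rewrite ?oner_neq0 // => *; rewrite big_nil.
rewrite -Dks.
(* Condition [j] makes the marginal of slot [j] uniform, the other slots being those of [ks] with
   position [j] removed. *)
have [E E0 EE] := generic_ltn
  (fun j => uniform_marginal (take j ks ++ drop j.+1 ks) (nth k0 ks j))
  (size ks).
exists E => // x nE zs Hzs zs0.
under eq_bigr do rewrite mean_rootE.
apply: (zero_sum_averages _ _ _ zs0) => [k|ks1 k ks2 Dks12|].
- by rewrite size_roots_at -subn1 subn_gt0.
- have lt_j : (size ks1 < size ks)%N.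
    by rewrite Dks12 size_cat /= addnS ltnS leq_addr.
  have Ek : nth k0 ks (size ks1) = k by rewrite Dks12 nth_cat ltnn subnn.
  have Eks : take (size ks1) ks ++ drop (size ks1).+1 ks = ks1 ++ ks2.
    by rewrite Dks12 take_size_cat // -cat_rcons drop_size_cat ?size_rcons.
  by have := EE x nE _ lt_j; rewrite Ek Eks.
elim: (ks) (zs) Hzs => [|k ks'' IH] [|z zs'] //= /andP[rz /IH ->].
by rewrite roots_atE root_prod_XsubC in rz; rewrite rz.
Qed.

End GenericSums.

(** * Almost periodicity *)

Section Cis.
Variable R : realType.
Implicit Types t x : R.

Definition cis t : R[i] := (cos t +i* sin t)%C.

Lemma cis0 : cis 0 = 1.
Proof. by rewrite /cis cos0 sin0. Qed.

Lemma cisD s t : cis (s + t) = cis s * cis t.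
Proof. by rewrite /cis cosD sinD; simpc; congr (_ +i* _)%C; rewrite addrC. Qed.

Lemma cis_sum (I : Type) (r : seq I) (F : I -> R) :
  cis (\sum_(i <- r) F i) = \prod_(i <- r) cis (F i).
Proof. exact: (big_morph cis cisD cis0). Qed.

Lemma cisMn t k : cis (t *+ k) = cis t ^+ k.
Proof. by elim: k => [|k IH]; rewrite ?cis0 // mulrS cisD IH exprS. Qed.

Lemma norm_cis t : `|cis t| = 1.
Proof. by rewrite normc_def /= cos2Dsin2 sqrtr1. Qed.

Lemma cis_neq1 t : t != 0 -> `|t| < pi -> cis t != 1.
Proof.
move=> t0 tpi; rewrite eq_complex /= negb_and; apply/orP; right.
wlog t_gt0 : t t0 tpi / 0 < t.
  move=> H; have [/H->//|] := ltP 0 t.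
  rewrite le_eqVlt (negPf t0) /= -oppr_gt0 => nt.
  by rewrite -oppr_eq0 -sinN H ?oppr_eq0 ?normrN.
by rewrite gt_eqF // sin_gt0_pi // t_gt0 -(gtr0_norm t_gt0).
Qed.

End Cis.

(** It suffices to bound [(p+1)^(d+1) * rho^p] by some [B] for all [p]: then any [p] with [B < p+1]
    works. *)
Lemma expr_poly_small (R : realType) (rho : R) d :
  0 <= rho < 1 -> exists p, p.+1%:R ^+ d * rho ^+ p < 1.
Proof.
suff bd : forall d (rho : R), 0 <= rho < 1 ->
    exists B, forall p, p.+1%:R ^+ d * rho ^+ p <= B.
  move=> /(bd d.+1)[B HB].
  exists (Num.truncn B); set p := Num.truncn B.
  have lt_Bp : B < p.+1%:R by exact: truncnS_gt.
  have p0 : 0 < p.+1%:R :> R by rewrite ltr0n.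
  rewrite -(ltr_pM2l p0) mulr1 mulrA -exprS.
  exact: le_lt_trans (HB p) lt_Bp.
elim=> [|e IH] {}rho /andP[rho0 rho1].
  by exists 1 => p; rewrite expr0 mul1r exprn_ile1 // ltW.
(* Writing [rho^p = s^p * s^p] leaves one factor for the induction hypothesis and one to absorb the
   extra [p+1]. *)
pose s : R := Num.sqrt rho.
have s0 : 0 <= s by exact: sqrtr_ge0.
have s1 : s < 1 by rewrite -sqrtr1 ltr_sqrt.
have [|B HB] := IH s; first by rewrite s0.
have B0 : 0 <= B by apply: le_trans (HB 0%N); rewrite expr0 mulr1 exprn_ge0.
have linear p : p.+1%:R * s ^+ p <= (1 - s)^-1.
  rewrite -[_^-1]mul1r ler_pdivlMr ?subr_gt0 //.
  (* That is, [(p+1) s^p] is at most the geometric sum [1 + s + ... + s^p]. *)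
  suff : p.+1%:R * s ^+ p * (1 - s) + s ^+ p.+1 <= 1.
    by apply: le_trans; rewrite lerDl exprn_ge0.
  elim: p => [|p IHp]; first by rewrite expr0 expr1 !mul1r subrK.
  have sp1 : s ^+ p.+1 <= 1 by rewrite exprn_ile1 // ltW.
  have -> : p.+2%:R * s ^+ p.+1 * (1 - s) + s ^+ p.+2 =
      s * (p.+1%:R * s ^+ p * (1 - s) + s ^+ p.+1) + s ^+ p.+1 * (1 - s).
    by rewrite -(natr1 p.+1) !(exprS s); ring.
  rewrite -[leRHS](subrKC s) lerD //; first by rewrite ler_piMr.
  by rewrite ler_piMl // subr_ge0 ltW.
exists (B * (1 - s)^-1) => p.
have -> : p.+1%:R ^+ e.+1 * rho ^+ p =
    (p.+1%:R ^+ e * s ^+ p) * (p.+1%:R * s ^+ p).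
  by rewrite -(sqr_sqrtr rho0) -/s -exprM mul2n -addnn exprD exprS; ring.
by rewrite ler_pM // mulr_ge0 ?exprn_ge0 ?ler0n.
Qed.

Section Averaging.
Variable R : realType.
Local Notation C := R[i].

(** Multiplying by [cis (- (t * x))] and summing over [K] terms of an arithmetic progression gives
    [K * c x] plus geometric sums bounded independently of [K]. *)
Lemma coef_le_sup (X : seq R) (c : R -> C) (B T : R) :
  uniq X -> (forall t, T <= t -> `|\sum_(x <- X) c x * cis (t * x)| <= B%:C) ->
  {in X, forall x, `|c x| <= B%:C}.
Proof.
move=> uX bnd x xX.
pose S : R := \sum_(y <- X) `|y|; have S0 : 0 <= S by exact: sumr_ge0.
have leS y : y \in X -> `|y| <= S.
  by move=> yX; rewrite /S (big_rem y) //= lerDl sumr_ge0.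
(* The step is so small that [h * (y - x)] stays in [(-1, 1)], hence no ratio [z y] with [y != x]
   equals 1. *)
pose h : R := (1 + (S + S))^-1.
have S1 : 0 < 1 + (S + S) by rewrite ltr_wpDr // addr_ge0.
have h0 : 0 < h by rewrite invr_gt0.
pose z y := cis (h * (y - x)).
have z_neq1 y : y \in X -> y != x -> z y - 1 != 0.
  move=> yX yx; rewrite subr_eq0 cis_neq1 //.
    by rewrite mulf_neq0 ?subr_eq0 // gt_eqF.
  have : `|h * (y - x)| < 1.
    rewrite normrM (gtr0_norm h0) mulrC ltr_pdivrMr // mul1r.
    apply: le_lt_trans (ler_normB _ _) _.
    by apply: le_lt_trans (lerD (leS _ yX) (leS _ xX)) _; rewrite ltrDr.
  by move/lt_le_trans; apply; apply: le_trans (pi_ge2 R); rewrite ler1n.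
(* Uses [|z^K - 1| <= 2] in each geometric sum. *)
pose D := \sum_(y <- X | y != x) `|c y| * (2 / `|z y - 1|).
have D0 : 0 <= D by apply: sumr_ge0 => y _; rewrite mulr_ge0 ?divr_ge0 ?ler0n.
have main K : K%:R * `|c x| <= K%:R * B%:C + D.
  pose t (n : nat) := T + h *+ n.
  have bndt n : `|\sum_(y <- X) c y * cis (t n * y)| <= B%:C.
    by apply: bnd; rewrite lerDl mulrn_wge0 // ltW.
  have : `|\sum_(n < K) (\sum_(y <- X) c y * cis (t n * y)) * cis (- (t n * x))|
      <= K%:R * B%:C.
    apply: le_trans (ler_norm_sum _ _ _) _.
    rewrite -[K in K%:R]card_ord mulr_natl -sumr_const; apply: ler_sum => n _.
    by rewrite normrM norm_cis mulr1.
  have -> : \sum_(n < K) (\sum_(y <- X) c y * cis (t n * y)) * cis (- (t n * x))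
      = K%:R * c x + \sum_(y <- X | y != x)
          c y * cis (T * (y - x)) * \sum_(n < K) z y ^+ n.
    transitivity (\sum_(y <- X)
        c y * cis (T * (y - x)) * \sum_(n < K) z y ^+ n).
      under eq_bigr do rewrite mulr_suml.
      rewrite exchange_big /=; apply: eq_bigr => y _.
      rewrite mulr_sumr; apply: eq_bigr => n _.
      rewrite -!mulrA -!cisD -cisMn -cisD; congr (_ * cis _).
      by rewrite /t -mulrnAl; ring.
    rewrite (bigD1_seq x) //=; congr (_ + _).
    rewrite /z subrr !mulr0 cis0 mulr1 mulrC; congr (_ * _).
    by under eq_bigr do rewrite expr1n; rewrite sumr_const card_ord.
  move=> le1; rewrite -[K%:R * `|c x|]subr0.
  have -> : K%:R * `|c x| = `|K%:R * c x| by rewrite normrM normr_nat.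
  rewrite subr0 -[K%:R * c x in leLHS](addrK (\sum_(y <- X | y != x)
          c y * cis (T * (y - x)) * \sum_(n < K) z y ^+ n)).
  apply: le_trans (ler_normB _ _) (lerD le1 _).
  apply: le_trans (ler_norm_sum _ _ _) _.
  rewrite /D big_seq_cond [leRHS]big_seq_cond.
  apply: ler_sum => y /andP[yX yx]; have zn0 := z_neq1 _ yX yx.
  rewrite normrM normrM norm_cis mulr1 ler_wpM2l // ler_pdivlMr ?normr_gt0 //.
  rewrite -normrM mulrC -subrX1.
  by apply: le_trans (ler_normB _ _) _; rewrite normrX norm_cis expr1n normr1.
have /ger0_real/RRe_real DE := D0.
have /ger0_real/RRe_real cE := normr_ge0 (c x).
rewrite -cE lecR leNgt; apply/negP; rewrite -subr_gt0 => gap.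
set r := complex.Re `|c x| in cE gap *; set d := complex.Re D in DE.
(* More than [d / (r - B)] samples contradict [main]. *)
have := main (Num.truncn (d / (r - B))).+1; rewrite -cE -DE.
rewrite -(rmorph_nat (real_complex R)) -!rmorphM -rmorphD lecR -lerBlDl -mulrBr.
by rewrite leNgt -ltr_pdivrMr // truncnS_gt.
Qed.

Lemma exp_sum_expand (J : finType) (k : J -> C) (th : J -> R) p t :
  (\sum_j k j * cis (t * th j)) ^+ p =
  \sum_(a : {ffun 'I_p -> J})
     (\prod_i k (a i)) * cis (t * \sum_i th (a i)).
Proof.
rewrite -[p in LHS]card_ord -prodr_const bigA_distr_bigA.
apply: eq_bigr => a _; rewrite big_split /=; congr (_ * _).
by rewrite mulr_sumr cis_sum.
Qed.

(** A sum depends only on how often each index occurs, and each of these [#|J|] numbers lies between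
    0 and [p]. *)
Lemma size_sums_le (J : finType) (th : J -> R) p :
  (size (undup [seq (\sum_i th (a i))%R | a : {ffun 'I_p -> J}]) <=
   p.+1 ^ #|J|)%N.
Proof.
rewrite -[p.+1 in leqRHS]card_ord -card_ffun.
pose f (m : {ffun J -> 'I_p.+1}) := \sum_j th j *+ m j.
rewrite -(size_image f); apply: uniq_leq_size; first exact: undup_uniq.
move=> x; rewrite mem_undup => /mapP[a _ ->].
have lt_card j : (#|[set i | a i == j]| < p.+1)%N.
  by rewrite ltnS -[leqRHS]card_ord max_card.
apply/fintype.imageP; exists [ffun j => Ordinal (lt_card j)] => //.
rewrite /f (partition_big a predT) //=; apply: eq_bigr => j _.
rewrite ffunE /= -sumr_const big_mkcond [RHS]big_mkcond /=.
by apply: eq_bigr => i _; rewrite inE; case: eqP => // ->.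
Qed.

(* Bohr's argument: expand the p-th power of the sum; the coefficients of the
   distinct frequencies are bounded by the p-th power of the supremum, there
   are only polynomially many of them, and without cancellation among the
   signs their moduli sum to 1. *)
Lemma almost_return (J : finType) (om th : J -> R) (ep : J -> bool) :
  (forall j, 0 < om j) -> \sum_j om j = 1 ->
  (forall a b : seq J, size a = size b ->
     \sum_(j <- a) th j = \sum_(j <- b) th j ->
     (\sum_(j <- a) ep j = \sum_(j <- b) ep j)%N) ->
  forall rho T : R, rho < 1 -> exists2 t, T <= t &
    rho%:C < `|\sum_j (-1) ^+ ep j * (om j)%:C * cis (t * th j)|.
Proof.
move=> om0 om1 indep rho T rho1.
wlog rho0 : rho rho1 / 0 <= rho.
  move=> H; have [rho0|rho_lt0] := leP 0 rho; first exact: H.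
  have [t tT Ht] := H 0 ltr01 (lexx _); exists t => //.
  by apply: lt_trans Ht; rewrite ltcR.
pose f t := \sum_j (-1) ^+ ep j * (om j)%:C * cis (t * th j).
apply: contrapT => none.
have bnd t : T <= t -> `|f t| <= rho%:C.
  move=> tT; rewrite real_leNgt ?normr_real // ?complex_real //.
  by apply/negP => lt_f; apply: none; exists t.
(* For this [p] the opposite inequality [1 <= (p+1)^#|J| * rho^p] is derived from [bnd]. *)
have [|p] := @expr_poly_small R rho #|J|; first by rewrite rho0.
apply/negP; rewrite -leNgt.
pose sm (a : {ffun 'I_p -> J}) := \sum_i th (a i).
pose cf (a : {ffun 'I_p -> J}) : C :=
  \prod_i ((-1) ^+ ep (a i) * (om (a i))%:C).
pose w (a : {ffun 'I_p -> J}) : R := \prod_i om (a i).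
pose X := undup [seq sm a | a : {ffun 'I_p -> J}].
pose c x : C := \sum_(a | sm a == x) cf a.
have smX a : sm a \in X by rewrite mem_undup; apply: fintype.image_f.
have regroup (V : nmodType) (F : {ffun 'I_p -> J} -> V) :
    \sum_a F a = \sum_(x <- X) \sum_(a | sm a == x) F a.
  under [RHS]eq_bigr do rewrite big_mkcond.
  rewrite exchange_big; apply: eq_bigr => a _ /=.
  rewrite (bigD1_seq (sm a)) ?undup_uniq //= eqxx big1 ?addr0 // => x.
  by rewrite eq_sym => /negPf ->.
have expand t : f t ^+ p = \sum_(x <- X) c x * cis (t * x).
  rewrite exp_sum_expand regroup; apply: eq_bigr => x _.
  by rewrite mulr_suml; apply: eq_bigr => a /eqP <-.
have cle : {in X, forall x, `|c x| <= (rho ^+ p)%:C}.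
  apply: (@coef_le_sup X c (rho ^+ p) T); first exact: undup_uniq.
  move=> t tT; rewrite -expand normrX rmorphXn /=.
  by rewrite lerXn2r ?nnegrE ?normr_ge0 ?ler0c ?bnd.
have cfE a : cf a = (-1) ^+ (\sum_i ep (a i))%N * (w a)%:C.
  rewrite /cf big_split /= /w rmorph_prod; congr (_ * _).
  by rewrite (big_morph _ (exprD _) (expr0 _)).
(* By [indep], tuples with the same frequency have the same sign, so nothing cancels within
   [c x]. *)
have cE x : `|c x| = (\sum_(a | sm a == x) w a)%:C.
  have [[a0 Ea0]|nox] := pselect (exists a, sm a == x); last first.
    rewrite /c !big_pred0 ?normr0 // => a; apply/negP => Ea; apply: nox;
    by exists a.
  have -> : c x = (-1) ^+ (\sum_i ep (a0 i))%N * (\sum_(a | sm a == x) w a)%:C.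
    rewrite /c rmorph_sum mulr_sumr; apply: eq_bigr => a /eqP Ea.
    rewrite cfE; congr ((-1) ^+ _ * _).
    have := indep [seq a i | i <- index_enum 'I_p]
                  [seq a0 i | i <- index_enum 'I_p].
    rewrite !size_map !big_map; apply => //.
    by move/eqP: Ea0; rewrite -Ea.
  rewrite normrM normrX normrN normr1 expr1n mul1r ger0_norm // ler0c.
  by apply: sumr_ge0 => a _; apply: prodr_ge0 => i _; exact: ltW.
have sum1 : \sum_a w a = 1.
  rewrite /w -(bigA_distr_bigA (fun=> om)) /= prodr_const om1 expr1n //.
rewrite -lecR -[X in X%:C <= _]sum1 regroup rmorph_sum /=.
under eq_bigr do rewrite -cE.
rewrite big_seq; apply: (le_trans (ler_sum _ cle)).
rewrite -big_seq big_const_seq count_predT iter_addr_0.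
rewrite -(rmorphMn (real_complex R)).
rewrite lecR -[leLHS]mulr_natl -natrX ler_wpM2r ?exprn_ge0 // ler_nat.
exact: size_sums_le.
Qed.

End Averaging.

(** * Spectral measures *)

Section Spectral.
Variables (R : rcfType) (n' : nat).
Local Notation n := n'.+1.
Implicit Types (N : 'M[R]_n) (s d h : 'cV[R]_n) (p : {poly R}).

Definition dot s h : R := (s^T *m h) 0 0.

Lemma dotC s h : dot s h = dot h s.
Proof. by rewrite /dot !mxE; apply: eq_bigr => i _; rewrite !mxE mulrC. Qed.

Lemma dotDr s g h : dot s (g + h) = dot s g + dot s h.
Proof. by rewrite /dot mulmxDr mxE. Qed.

Lemma dotZr a s h : dot s (a *: h) = a * dot s h.
Proof. by rewrite /dot -scalemxAr mxE. Qed.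

Lemma dot_sqE h : dot h h = \sum_i h i 0 ^+ 2.
Proof. by rewrite /dot mxE; apply: eq_bigr => i _; rewrite mxE expr2. Qed.

Lemma dot_sq_eq0 h : dot h h = 0 -> h = 0.
Proof.
move=> h0; apply/colP => i; rewrite !mxE.
have /psumr_eq0P : \sum_i h i 0 ^+ 2 = 0 by rewrite -dot_sqE.
move=> /(_ (fun j _ => sqr_ge0 _) i isT)/eqP.
by rewrite sqrf_eq0 => /eqP.
Qed.

Lemma tr_horner_mx N p : N^T = N -> (horner_mx N p)^T = horner_mx N p.
Proof.
move=> symN; elim/poly_ind: p => [|p c IH]; first by rewrite rmorph0 trmx0.
rewrite rmorphD rmorphM /= horner_mx_X horner_mx_C linearD /= tr_scalar_mx.
rewrite -[horner_mx N p * N]/(_ *m _) trmx_mul IH symN; congr (_ + _).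
by have := comm_horner_mx p (comm_mx_refl N) => ->.
Qed.

Lemma dot_horner_mx N s h p q : N^T = N ->
  dot (horner_mx N p *m s) (horner_mx N q *m h) =
  dot s (horner_mx N (p * q) *m h).
Proof.
move=> symN; rewrite /dot trmx_mul tr_horner_mx // -!mulmxA.
by rewrite rmorphM /= -mulmxE !mulmxA.
Qed.

(** The nodes are the eigenvalues of [N] with an eigenvector not orthogonal to [s]; only the values
    of [om] on [L] matter. The bound on [size L] serves the estimates of [node_sum_gap]. *)
Definition spectral_measure N s (L : seq R) (om : R -> R) : Prop :=
  [/\ uniq L, (size L <= n)%N, {in L, forall l, 0 < om l} &
      forall p, dot s (horner_mx N p *m s) = \sum_(l <- L) om l * p.[l]].

(** Unitary diagonalization over [R[i]]: the weight of an eigenvalue sums the squared moduli of the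
    coordinates of [s] in its eigenvectors. *)
Lemma spectral_measure_exists N s : N^T = N ->
  exists L om, spectral_measure N s L om.
Proof.
move=> symN; pose NC := map_mx (real_complex R) N.
have hermN : NC \is hermsymmx.
  apply: realsym_hermsym.
    apply/is_hermitianmxP; rewrite expr0 scale1r map_mx_id //.
    by rewrite /NC map_trmx symN.
  by apply/mxOverP => i j; rewrite mxE complex_real.
have /orthomx_spectralP := hermitian_normalmx hermN.
have Ureal := hermitian_spectral_diag_real hermN.
have Uunit := spectral_unitarymx NC.
move: (spectralmx NC) (spectral_diag NC) Ureal Uunit => U D Dreal Uunit NE.
pose lam j : R := complex.Re (D 0 j).
have lamE j : (lam j)%:C = D 0 j by apply: RRe_real; exact: (mxOverP Dreal).
pose c := U *m map_mx (real_complex R) s.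
pose w j : R := complex.Re (`|c j 0| ^+ 2).
have wE j : (w j)%:C = `|c j 0| ^+ 2.
  by apply: RRe_real; rewrite ger0_real // exprn_ge0.
have w0 j : 0 <= w j by rewrite -ler0c wE exprn_ge0.
have moment p : dot s (horner_mx N p *m s) = \sum_j w j * p.[lam j].
  apply: complexI; rewrite rmorph_sum /=.
  have -> : (dot s (horner_mx N p *m s))%:C =
      ((map_mx Num.conj c)^T *m
       diag_mx (map_mx (horner (map_poly (real_complex R) p)) D) *m c) 0 0.
    have -> : forall B : 'M[R]_1, (B 0 0)%:C = map_mx (real_complex R) B 0 0.
      by move=> B; rewrite mxE.
    have -> : (map_mx Num.conj c)^T =
        map_mx (real_complex R) s^T *m invmx U.
      rewrite invmx_unitary // /c map_mxM trmx_mul !map_trmx -map_mx_comp.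
      by congr (_ *m _); apply/matrixP => i j; rewrite !mxE; exact: conjc_real.
    rewrite !map_mxM map_horner_mx -/NC NE horner_mx_uconjC; last first.
      exact: unitarymx_unit.
    by rewrite horner_mx_diag /c !mulmxA.
  rewrite mxE; apply: eq_bigr => j _.
  rewrite mul_mx_diag !mxE rmorphM /= wE normCK -lamE horner_map /=.
  have <- : c j 0 = \sum_k U j k * map_mx (real_complex R) s k 0 by rewrite mxE.
  by rewrite mulrAC [X in X * _]mulrC.
(* Equal eigenvalues are merged and those of weight zero dropped, which makes the weights
   positive. *)
exists (undup [seq lam j | j <- enum 'I_n & w j != 0]).
exists (fun l => \sum_(j | lam j == l) w j); split.
- exact: undup_uniq.
- apply: leq_trans (size_undup _) _; rewrite size_map size_filter.
  by apply: leq_trans (count_size _ _) _; rewrite size_enum_ord.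
- move=> l; rewrite mem_undup => /mapP[j]; rewrite mem_filter => /andP[wj _] ->.
  rewrite (bigD1 j) //= ltr_pwDl ?sumr_ge0 //.
  by rewrite lt_def wj w0.
move=> p; rewrite moment.
under [RHS]eq_bigr do rewrite mulr_suml big_mkcond.
rewrite exchange_big /=; apply: eq_bigr => j _.
have [->|wj] := eqVneq (w j) 0.
  by rewrite mul0r big1 // => l _; rewrite mul0r if_same.
rewrite (bigD1_seq (lam j)) ?undup_uniq //=; last first.
  by rewrite mem_undup; apply/mapP; exists j; rewrite // mem_filter wj mem_enum.
rewrite eqxx big1 ?addr0 // => l.
by rewrite eq_sym => /negPf ->.
Qed.

(** The Lagrange basis polynomial at [l], not normalized. *)
Definition others (L : seq R) (l : R) : {poly R} :=
  \prod_(m <- L | m != l) ('X - m%:P).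

Definition node_poly (L : seq R) : {poly R} := \prod_(l <- L) ('X - l%:P).

(* node_poly L times the Cauchy transform of the measure *)
Definition weight_poly (L : seq R) (om : R -> R) : {poly R} :=
  \sum_(l <- L) om l *: others L l.

Lemma node_polyD1 L l : uniq L -> l \in L ->
  node_poly L = ('X - l%:P) * others L l.
Proof. by move=> uL lL; rewrite /node_poly (bigD1_seq l). Qed.

Lemma others_neq0 L l : (others L l).[l] != 0.
Proof.
rewrite /others horner_prod prodf_seq_neq0; apply/allP => m _.
by apply/implyP => ml; rewrite !hornerE subr_eq0 eq_sym.
Qed.

Lemma others_eq0 L l m : m \in L -> m != l -> (others L l).[m] = 0.
Proof.
move=> mL ml; apply/eqP; rewrite /others horner_prod prodf_seq_eq0.
by apply/hasP; exists m; rewrite // ml !hornerE subrr /=.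
Qed.

Lemma weight_poly_node L om l : uniq L -> l \in L ->
  (weight_poly L om).[l] = om l * (others L l).[l].
Proof.
move=> uL lL; rewrite /weight_poly horner_sum (bigD1_seq l) //= hornerZ.
rewrite big_seq_cond big1 ?addr0 // => m /andP[_ ml].
by rewrite hornerZ others_eq0 ?mulr0 // eq_sym.
Qed.

Section Measure.
Variables (N : 'M[R]_n) (s : 'cV[R]_n) (L : seq R) (om : R -> R).
Hypotheses (symN : N^T = N) (meas : spectral_measure N s L om).

(** The squared norm of this vector is the integral of [node_poly L ^+ 2], which vanishes at every
    node. *)
Lemma node_poly_annihilates : horner_mx N (node_poly L) *m s = 0.
Proof.
have [_ _ _ mom] := meas; apply: dot_sq_eq0.
rewrite dot_horner_mx // mom big_seq big1 // => l lL.
have /eqP rl : root (node_poly L) l by rewrite root_prod_XsubC.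
by rewrite hornerM rl !mulr0.
Qed.

(** [others L l] vanishes at all other nodes, so [h] is a nonzero multiple of the projection of [s]
    to the eigenspace of [l]. *)
Lemma spectral_eigenvector l : l \in L ->
  let h := horner_mx N (others L l) *m s in N *m h = l *: h /\ dot s h != 0.
Proof.
have [uL _ om0 mom] := meas; move=> lL h; split; last first.
  rewrite /h mom (bigD1_seq l) //= big_seq_cond big1 ?addr0; last first.
    by move=> m /andP[mL ml]; rewrite others_eq0 ?mulr0.
  by rewrite mulf_neq0 ?others_neq0 // gt_eqF ?om0.
have := node_poly_annihilates; rewrite (node_polyD1 uL lL) rmorphM rmorphB /=.
rewrite horner_mx_X horner_mx_C -mulmxE -mulmxA -/h mulmxBl mul_scalar_mx.
by move/eqP; rewrite subr_eq0 => /eqP.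
Qed.

(** If every node were at most [t], the integral of [(l - t) p(l)^2] could not be positive. *)
Lemma rayleigh_lt p t :
  t * dot (horner_mx N p *m s) (horner_mx N p *m s) <
    dot (horner_mx N p *m s) (N *m (horner_mx N p *m s)) ->
  exists2 l, l \in L & t < l.
Proof.
have [_ _ om0 mom] := meas => Hlt.
apply/hasP; apply: contraLR Hlt => /hasPn Ht; rewrite -leNgt.
have -> : N *m (horner_mx N p *m s) = horner_mx N ('X * p) *m s.
  by rewrite rmorphM /= horner_mx_X -mulmxE mulmxA.
rewrite !dot_horner_mx // !mom mulr_sumr big_seq [leRHS]big_seq.
apply: ler_sum => l lL; have := Ht l lL; rewrite -leNgt => le_lt.
rewrite !hornerM hornerX.
have -> : om l * (p.[l] * (l * p.[l])) = om l * p.[l] ^+ 2 * l by ring.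
have -> : t * (om l * (p.[l] * p.[l])) = om l * p.[l] ^+ 2 * t by ring.
by rewrite ler_wpM2l // mulr_ge0 ?sqr_ge0 // ltW // om0.
Qed.

End Measure.

(* Testing (N - l) against q(N) s, where q = (F - F(l)) / (X - l), turns the
   eigenvalue equation for N + Q into the secular equation. *)
Lemma secular_equation N Q s d L om x l h :
  N^T = N -> spectral_measure N s L om ->
  (forall p, dot s (horner_mx N p *m d) = 0) ->
  (forall g, Q *m g = (x / 2) *: (dot s g *: s + dot d g *: d)) ->
  (N + Q) *m h = l *: h -> dot s h != 0 ->
  (node_poly L).[l] = x * (weight_poly L (fun m => om m / 2)).[l].
Proof.
move=> symN meas cross QE eig sh0; have [uL _ _ mom] := meas.
pose F := node_poly L.
have [q Fq] : exists q, F - (F.[l])%:P = q * ('X - l%:P).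
  by apply/factor_theorem; rewrite /root !hornerE subrr.
(* Since [F(m) = 0], the quotient is [q(m) = F(l) / (l - m)]; the case [m = l] is treated by
   cancelling [X - l]. *)
have qE m : m \in L -> q.[m] = (others L m).[l].
  move=> mL; have [lm|ml] := eqVneq m l.
    have Fl0 : F.[l] = 0.
      by apply/eqP; rewrite -[_ == 0]/(root F l) root_prod_XsubC -lm.
    have := Fq; rewrite Fl0 subr0 /F (node_polyD1 uL mL) lm mulrC.
    by move/(mulIf (negbT (polyXsubC_eq0 _))) ->.
  have /eqP Fm0 : F.[m] == 0 by rewrite -[_ == 0]/(root F m) root_prod_XsubC.
  have := congr1 (horner^~ m) Fq; rewrite !hornerE /= Fm0 add0r.
  rewrite /F (node_polyD1 uL mL) !hornerE /= -mulNr opprB => /esym.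
  by rewrite mulrC => /mulfI; apply; rewrite subr_eq0.
have Fh0 : dot s (horner_mx N F *m h) = 0.
  have := dot_horner_mx s h F 1 symN.
  by rewrite mulr1 (node_poly_annihilates symN meas) /dot trmx0 mul0mx mxE.
have Nh : Q *m h = horner_mx N (l%:P - 'X) *m h.
  rewrite rmorphB /= horner_mx_C horner_mx_X mulmxBl mul_scalar_mx -eig.
  by rewrite mulmxDl addrAC subrr add0r.
(* Here [q(N) (l - N) = F(l) - F(N)], and [F(N)] contributes nothing against [s]. *)
have lhs : dot s (horner_mx N q *m (Q *m h)) = F.[l] * dot s h.
  rewrite Nh mulmxA mulmxE -rmorphM /= -opprB mulrN -Fq opprB rmorphB /=.
  rewrite horner_mx_C mulmxBl mul_scalar_mx -scaleN1r dotDr !dotZr Fh0.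
  by rewrite mulr0 addr0.
(* On the other side [cross] kills the [d] component of [Q h], and the [s] component integrates [q]
   over the nodes. *)
apply: (mulIf sh0); rewrite -lhs QE -scalemxAr mulmxDr -!scalemxAr.
rewrite dotZr dotDr !dotZr cross mom mulr0 addr0 /weight_poly horner_sum.
rewrite !mulr_sumr mulr_suml big_seq [RHS]big_seq; apply: eq_bigr => m mL.
by rewrite hornerZ qE //; field.
Qed.

End Spectral.

(** * Equitable partitions and the potential at w *)

Section Graph.
Variables (R : realType) (n' : nat).
Local Notation n := n'.+1.

(** The row is that of an entry of [h] of maximal modulus. Keeping [h i 0 != 0] lets [node_diffv_le]
    exclude the row of [w]. *)
Lemma gershgorin (M : 'M[R]_n) (h : 'cV[R]_n) l :
  (forall i j, i != j -> `|M i j| <= 1) -> h != 0 -> M *m h = l *: h ->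
  exists2 i, h i 0 != 0 & `|l - M i i| <= n%:R.
Proof.
move=> M1 h0 eig.
pose i := [arg max_(i > ord0) `|h i 0| : R]%O.
have max_i j : `|h j 0| <= `|h i 0|.
  by rewrite /i; case: Order.TotalTheory.arg_maxP => // k _; apply.
have hi0 : h i 0 != 0.
  apply: contraNneq h0 => hi0; apply/eqP/colP => j; rewrite mxE.
  by apply/eqP; rewrite -normr_le0 -(normr0 R) -hi0.
exists i => //.
have hi_gt0 : 0 < `|h i 0| by rewrite normr_gt0.
rewrite -(ler_pM2r hi_gt0) -normrM.
have -> : (l - M i i) * h i 0 = \sum_(j | j != i) M i j * h j 0.
  have := congr1 (fun B : 'cV[R]_n => B i 0) eig.
  rewrite !mxE (bigD1 i) //= => eigi.
  by rewrite mulrBl -eigi addrAC subrr add0r.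
apply: le_trans (ler_norm_sum _ _ _) _.
apply: le_trans (_ : \sum_(j | j != i) `|h i 0| <= _).
  apply: ler_sum => j ji; rewrite normrM -[leRHS]mul1r.
  by rewrite ler_pM // M1 // eq_sym.
rewrite sumr_const -[leLHS]mulr_natl ler_wpM2r // ler_nat.
by rewrite -[leqRHS]card_ord max_card.
Qed.

Lemma potentialE q x (h : 'cV[R]_n) :
  potential q x *m h = (q * h x 0) *: delta_mx x 0.
Proof.
apply/colP => i; rewrite !mxE (bigD1 x) //= big1 => [|j jx].
  by rewrite !mxE eqxx andbT addr0; ring.
by rewrite !mxE (negPf jx) andbF mulr0 mul0r.
Qed.

Lemma dot_delta (i : 'I_n) (h : 'cV[R]_n) : dot (delta_mx i 0) h = h i 0.
Proof.
rewrite /dot mxE (bigD1 i) //= big1 => [|j ji]; rewrite !mxE.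
  by rewrite !eqxx mul1r addr0.
by rewrite (negPf ji) mul0r.
Qed.

Definition sumv (u v : 'I_n) : 'cV[R]_n := delta_mx u 0 + delta_mx v 0.
Definition diffv (u v : 'I_n) : 'cV[R]_n := delta_mx u 0 - delta_mx v 0.

Lemma dot_sumv u v h : dot (sumv u v) h = h u 0 + h v 0.
Proof.
by rewrite /dot linearD mulmxDl mxE -/(dot _ _) -/(dot _ _) !dot_delta.
Qed.

Lemma dot_diffv u v h : dot (diffv u v) h = h u 0 - h v 0.
Proof.
by rewrite /dot linearB mulmxBl !mxE -/(dot _ _) -!dot_delta /dot !mxE.
Qed.

(** With [s] and [d] the two vectors, [e_u e_u^T + e_v e_v^T = (s s^T + d d^T) / 2]. *)
Lemma potential_pairE x u v (g : 'cV[R]_n) :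
  (potential x u + potential x v) *m g =
  (x / 2) *: (dot (sumv u v) g *: sumv u v + dot (diffv u v) g *: diffv u v).
Proof.
rewrite mulmxDl !potentialE dot_sumv dot_diffv.
by apply/colP => i; rewrite !mxE; field.
Qed.

Section Equitable.
Variables (A : 'M[R]_n) (P : {set {set 'I_n}}) (u v w : 'I_n).
Hypotheses (symA : A^T = A) (A_le1 : forall i j, `|A i j| <= 1).
Hypothesis A_diag : forall i, A i i = 0.
Hypotheses (equitP : equitable_partition A P) (neq_uv : u != v).
Hypotheses (uvP : [set u; v]%SET \in P) (wP : [set w]%SET \in P).
Local Notation s := (sumv u v).
Local Notation d := (diffv u v).

(** The orthogonal complement of the indicator vectors of the parts. *)
Definition balanced (f : 'cV[R]_n) : Prop :=
  forall Y, Y \in P -> \sum_(i in Y) f i 0 = 0.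

(** By symmetry and equitability the column sums of [A] over [Y] are constant on each part, and [f]
    sums to zero there. *)
Lemma balanced_mul f : balanced f -> balanced (A *m f).
Proof.
move=> balf Y YP; have [/and3P[/eqP covP triv _] equit] := equitP.
under eq_bigr do rewrite mxE.
rewrite exchange_big /=.
under eq_bigr do rewrite -mulr_suml.
rewrite (eq_bigl (fun j => j \in finset.cover P)) => [|j]; last first.
  by rewrite covP inE.
rewrite finset.big_trivIset //= big1 // => X XP.
have [x0 x0X|X0] := pickP (mem X); last first.
  by rewrite big1 // => i; rewrite [_ \in _]X0.
rewrite (eq_bigr (fun j => (\sum_(i in Y) A x0 i) * f j 0)) => [|j jX].
  by rewrite -mulr_sumr balf ?mulr0.
congr (_ * _); rewrite (equit X Y XP YP x0 j x0X jX).
by apply: eq_bigr => i _; rewrite -[in LHS]symA mxE.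
Qed.

Lemma balanced_w f : balanced f -> f w 0 = 0.
Proof. by move=> /(_ _ wP); rewrite big_set1. Qed.

Lemma dot_sumv_balanced f : balanced f -> dot s f = 0.
Proof.
move=> /(_ _ uvP); rewrite dot_sumv big_setU1 ?inE //= big_set1.
exact.
Qed.

Lemma balanced_diffv : balanced d.
Proof.
move=> Y YP; have [/and3P[_ /finset.trivIsetP triv _] _] := equitP.
have [->|neqY] := eqVneq Y [set u; v]%SET.
  rewrite big_setU1 ?inE //= big_set1 !mxE !eqxx (negPf neq_uv).
  by rewrite eq_sym (negPf neq_uv) /= subr0 add0r subrr.
have disj := triv _ _ YP uvP neqY.
rewrite big1 // => i iY; have := disjointFr disj iY; rewrite !inE => /negbT.
by rewrite negb_or => /andP[/negPf iu /negPf iv]; rewrite !mxE iu iv subrr.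
Qed.

Section Potential.
Variable y : R.
(** Only the potential at [w] is included; those at [u] and [v] enter later as the perturbation of
    [secular_equation]. *)
Definition base := A + potential y w.

Lemma sym_base : base^T = base.
Proof. by rewrite /base /potential linearD /= linearZ /= trmx_delta symA. Qed.

Lemma base_balanced f : balanced f -> base *m f = A *m f.
Proof.
by move=> bf; rewrite mulmxDl potentialE balanced_w // mulr0 scale0r addr0.
Qed.

Lemma balanced_horner f p : balanced f -> balanced (horner_mx base p *m f).
Proof.
elim/poly_ind: p f => [|p c IH] f bf Y YP.
  by rewrite rmorph0 mul0mx big1 // => i _; rewrite mxE.
rewrite rmorphD rmorphM /= horner_mx_C horner_mx_X mulmxDl -mulmxE -mulmxA.
under eq_bigr do rewrite mxE; rewrite big_split /=.
rewrite base_balanced // (IH _ (balanced_mul bf) Y YP) add0r.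
under eq_bigr do rewrite mul_scalar_mx mxE.
by rewrite -mulr_sumr bf ?mulr0.
Qed.

Lemma cross_sd p : dot s (horner_mx base p *m d) = 0.
Proof. exact/dot_sumv_balanced/balanced_horner/balanced_diffv. Qed.

Lemma cross_ds p : dot d (horner_mx base p *m s) = 0.
Proof.
have := dot_horner_mx d s 1 p sym_base; rewrite mul1r => <-.
rewrite dotC dot_horner_mx ?mulr1; first exact: cross_sd.
exact: sym_base.
Qed.

Hypothesis y_ge0 : 0 <= y.

Lemma base_offdiag i j : i != j -> `|base i j| <= 1.
Proof.
move=> ij; rewrite /base !mxE; case: (eqVneq i w) => [iw|_] /=; last first.
  by rewrite mulr0 addr0.
by rewrite -iw eq_sym (negPf ij) mulr0 addr0.
Qed.

Lemma base_diag i : i != w -> base i i = 0.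
Proof. by move=> /negPf iw; rewrite /base !mxE A_diag iw mulr0 addr0. Qed.

Lemma node_sumv_ge L om l :
  spectral_measure base s L om -> l \in L -> - n%:R <= l.
Proof.
move=> meas lL; have [eig sh] := spectral_eigenvector sym_base meas lL.
have h0 : horner_mx base (others L l) *m s != 0.
  by apply: contraNneq sh => ->; rewrite /dot mulmx0 mxE.
have [i _] := gershgorin base_offdiag h0 eig.
have : 0 <= base i i.
  by rewrite /base !mxE A_diag add0r mulr_ge0.
by rewrite ler_norml => ? /andP[? _]; lra.
Qed.

(** The eigenvector is balanced and so vanishes at [w]. The Gershgorin row is therefore another one,
    with diagonal entry 0, and the bound does not involve [y]. *)
Lemma node_diffv_le L om l :
  spectral_measure base d L om -> l \in L -> l <= n%:R.
Proof.
move=> meas lL; have [eig sh] := spectral_eigenvector sym_base meas lL.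
have h0 : horner_mx base (others L l) *m d != 0.
  by apply: contraNneq sh => ->; rewrite /dot mulmx0 mxE.
have [i hi] := gershgorin base_offdiag h0 eig.
rewrite base_diag ?subr0; first by rewrite ler_norml => /andP[].
apply: contraNneq hi => ->.
by rewrite balanced_w //; apply: balanced_horner; exact: balanced_diffv.
Qed.

End Potential.

Lemma base_exp_sumv y r : (forall j, (j < r)%N -> (A ^+ j *m s) w 0 = 0) ->
  base y ^+ r *m s = A ^+ r *m s.
Proof.
elim: r => [|r IH] van; first by rewrite !expr0.
rewrite !exprS -!mulmxE -!mulmxA IH => [|j jr]; last exact/van/ltnW.
by rewrite mulmxDl potentialE van // mulr0 scale0r addr0.
Qed.

(* A^r s is the first iterate that charges w, so it does not depend on y, and
   its Rayleigh quotient pushes the largest node up as y grows. *)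
Lemma node_sum_gap : (exists k, (A ^+ k *m s) w 0 != 0) ->
  exists2 y, 0 <= y & forall L om L' om',
    spectral_measure (base y) s L om -> spectral_measure (base y) d L' om' ->
    \sum_(l <- L') l < \sum_(l <- L) l.
Proof.
move=> reach; case: (ex_minnP reach) => r gw0 min_r.
have van j : (j < r)%N -> (A ^+ j *m s) w 0 = 0.
  by move=> jr; apply/eqP/negPn/negP => /min_r; rewrite leqNgt jr.
set g := A ^+ r *m s in gw0.
(* The [d]-nodes sum to at most [n^2] and the remaining [s]-nodes to at least [- n^2], so one
   [s]-node above [2 n^2] suffices. *)
pose t : R := (2 * n * n)%:R.
have gw2 : 0 < g w 0 ^+ 2 by rewrite exprn_even_gt0.
(* Chosen so that [y * g_w^2] lifts the Rayleigh quotient of [g] above [t]. *)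
exists (`|t * dot g g + 1 - dot g (A *m g)| / g w 0 ^+ 2) => [|L om L' om'].
  by rewrite divr_ge0 // ltW.
set y := _ / _ => meas meas'.
have y0 : 0 <= y by rewrite divr_ge0 // ltW.
have [l lL tl] : exists2 l, l \in L & t < l.
  apply: (rayleigh_lt (p := 'X^r) (sym_base y) meas).
  rewrite rmorphXn /= horner_mx_X base_exp_sumv // -/g mulmxDl potentialE.
  rewrite dotDr dotZr.
  rewrite [dot g (delta_mx _ _)]dotC dot_delta.
  have -> : y * g w 0 * g w 0 = `|t * dot g g + 1 - dot g (A *m g)|.
    by rewrite -mulrA -expr2 divfK // gt_eqF.
  by have := ler_norm (t * dot g g + 1 - dot g (A *m g)); lra.
have [uL sL _ _] := meas; have [_ sL' _ _] := meas'.
have up : \sum_(k <- L') k <= (n * n)%:R.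
  rewrite natrM; apply: le_trans (_ : \sum_(k <- L') n%:R <= _).
    rewrite big_seq [leRHS]big_seq; apply: ler_sum => k kL'.
    exact: node_diffv_le meas' kL'.
  rewrite big_const_seq count_predT iter_addr_0 -[leLHS]mulr_natl.
  by rewrite ler_wpM2r // ler_nat.
have lo : - (n * n)%:R <= \sum_(k <- L | k != l) k.
  apply: le_trans (_ : \sum_(k <- L | k != l) (- n%:R) <= _).
    rewrite big_const_seq iter_addr_0 mulNrn lerN2 natrM -[leLHS]mulr_natl.
    by rewrite ler_wpM2r // ler_nat (leq_trans (count_size _ _)).
  rewrite big_seq_cond [leRHS]big_seq_cond; apply: ler_sum => k /andP[kL _].
  exact: node_sumv_ge meas kL.
rewrite [ltRHS](bigD1_seq l) //=; apply: le_lt_trans up _.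
have : t = (n * n)%:R + (n * n)%:R by rewrite /t -natrD -mulnA mul2n addnn.
by move: tl lo; lra.
Qed.

End Equitable.
End Graph.

(** * The time evolution *)

Section Evolution.
Local Open Scope classical_set_scope.
Variable R : realType.

Lemma norm_le_ReIm (z : R[i]) :
  `|z| <= (`|complex.Re z| + `|complex.Im z|)%:C.
Proof.
rewrite {1}[z]complexE; apply: le_trans (ler_normD _ _) _.
have nr (x : R) : `|x%:C| = (`|x|)%:C.
  by rewrite normc_def /= expr0n addr0 sqrtr_sqr.
have ni : `|'i%C : R[i]| = 1 by rewrite normc_def /= expr0n expr1n add0r sqrtr1.
by rewrite normrM ni mul1r !nr rmorphD.
Qed.

Lemma cvg_complex (f : nat -> R[i]^o) (a b : R) :
  (fun k => complex.Re (f k)) @ \oo --> a ->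
  (fun k => complex.Im (f k)) @ \oo --> b ->
  f @ \oo --> (a +i* b : R[i]^o).
Proof.
move=> /cvgrPdist_lt cva /cvgrPdist_lt cvb; apply/cvgrPdist_lt => e e0.
have eE : (complex.Re e)%:C = e by rewrite RRe_real ?gtr0_real.
have e2 : 0 < complex.Re e / 2 by rewrite divr_gt0 // -ltcR eE.
near=> k.
have ha : `|a - complex.Re (f k)| < complex.Re e / 2 by near: k; exact: cva.
have hb : `|b - complex.Im (f k)| < complex.Re e / 2 by near: k; exact: cvb.
apply: le_lt_trans (norm_le_ReIm _) _; rewrite -eE ltcR.
have -> : complex.Re ((a +i* b : R[i]) - f k) = a - complex.Re (f k).
  by case: (f k).
have -> : complex.Im ((a +i* b : R[i]) - f k) = b - complex.Im (f k).
  by case: (f k).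
lra.
Unshelve. all: by end_near.
Qed.

Lemma exp_term (x : R) k :
  (k`!%:R)^-1 * ('i%C * x%:C) ^+ k = (cos_coeff x k +i* sin_coeff x k).
Proof.
rewrite exprMn -rmorphXn /= -(rmorph_nat (real_complex R)) -fmorphV /=.
have iX j : ('i%C : R[i]) ^+ j.*2 = ((-1) ^+ j)%:C.
  by rewrite -mul2n exprM sqr_i rmorphXn rmorphN1.
have -> : ('i%C : R[i]) ^+ k =
    (if odd k then 'i%C else 1) * ((-1) ^+ k./2)%:C.
  rewrite -iX -{1}(odd_double_half k) exprD.
  by case: (odd k); rewrite ?expr1 ?expr0.
rewrite /cos_coeff /sin_coeff /=.
case: (boolP (odd k)) => ok /=.
  have -> : k.-1./2 = k./2.
    by case: (k) ok => //= j oj; rewrite uphalf_half (negPf oj).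
  by simpc; rewrite -?exprnP; congr (_ +i* _); ring.
by simpc; rewrite -?exprnP; congr (_ +i* _); ring.
Qed.

Lemma cvg_lincomb (J : finType) (c l : J -> R) (g : J -> nat -> R) :
  (forall j, g j @ \oo --> l j) ->
  (fun k => \sum_j c j * g j k) @ \oo --> \sum_j c j * l j.
Proof.
move=> gl; apply: cvg_big => [|j _]; first exact: add_continuous.
by apply: cvgMl_tmp; exact: gl.
Qed.

Lemma cvg_cos (x : R) : series (cos_coeff x) @ \oo --> cos x.
Proof. by rewrite cos.unlock; exact: is_cvg_series_cos_coeff. Qed.

Lemma cvg_sin (x : R) : series (sin_coeff x) @ \oo --> sin x.
Proof. by rewrite sin.unlock; exact: is_cvg_series_sin_coeff. Qed.

(** The entries of the powers are moments of a signed measure with masses [c j] at [th j], so the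
    exponential series is a finite combination of cosine and sine series. *)
Lemma evolutionE n' (N : 'M[R]_n'.+1) u v t (J : finType) (c th : J -> R) :
  (forall k, (N ^+ k) u v = \sum_j c j * th j ^+ k) ->
  evolution N t u v = \sum_j (c j)%:C * cis (t * th j).
Proof.
move=> momN; rewrite /evolution /expmx mxE.
set f : nat -> R[i]^o := series _.
have sumC (I : Type) (r : seq I) (F G : I -> R) :
    \sum_(i <- r) (F i +i* G i) = (\sum_(i <- r) F i) +i* (\sum_(i <- r) G i).
  by elim/big_rec3: _ => // i a b _ _ ->.
have sumE (F G : J -> R) : \sum_j (c j)%:C * (F j +i* G j) =
    (\sum_j c j * F j) +i* (\sum_j c j * G j).
  by rewrite -sumC; apply: eq_bigr => j _; simpc.
have fE m : f m = (\sum_j c j * series (cos_coeff (t * th j)) m) +i*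
                  (\sum_j c j * series (sin_coeff (t * th j)) m).
  have termE k : (k`!%:R)^-1 *
        (('i%C *: map_mx (real_complex R) (t *: N)) ^+ k) u v =
      \sum_j (c j)%:C * (cos_coeff (t * th j) k +i* sin_coeff (t * th j) k).
    have -> : ('i%C *: map_mx (real_complex R) (t *: N)) ^+ k =
        ('i%C ^+ k * (t%:C) ^+ k) *: map_mx (real_complex R) (N ^+ k).
      by rewrite exprZn -rmorphXn /= exprZn map_mxZ scalerA rmorphXn.
    rewrite !mxE momN rmorph_sum !mulr_sumr; apply: eq_bigr => j _.
    by rewrite -exp_term !rmorphM rmorphXn /= !exprMn; ring.
  rewrite /f /series /=; under eq_bigr do rewrite termE.
  rewrite exchange_big /= -sumE; apply: eq_bigr => j _.
  by rewrite -mulr_sumr sumC.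
suff cvf : f @ \oo --> ((\sum_j c j * cos (t * th j)) +i*
    (\sum_j c j * sin (t * th j)) : R[i]^o).
  by rewrite /cis sumE; exact: (cvg_lim (@norm_hausdorff _ _) cvf).
apply: cvg_complex.
  under eq_cvg do rewrite fE /=; apply: cvg_lincomb => j; exact: cvg_cos.
under eq_cvg do rewrite fE /=; apply: cvg_lincomb => j; exact: cvg_sin.
Qed.

Lemma pgstP n (N : 'M[R]_n) u v :
  (forall t, `|evolution N t u v| <= 1) ->
  (forall rho T : R, rho < 1 ->
     exists2 t, T <= t & rho%:C < `|evolution N t u v|) ->
  pgst N u v.
Proof.
move=> le1 ret; rewrite /pgst limf_esupE; apply/eqP; rewrite eq_le.
have nE t : (complex.Re `|evolution N t u v|)%:C = `|evolution N t u v|.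
  by rewrite RRe_real // normr_real.
apply/andP; split.
  apply: ge_ereal_inf; eexists.
    by exists setT; [exact: filterT|reflexivity].
  apply: ge_ereal_sup => _ [t _ <-].
  by rewrite lee_fin -lecR nE.
apply: le_ereal_inf_tmp => _ [V [T [_ VT]] <-].
apply/lee_subgt0Pr => e e0.
(* The neighbourhood only contains the points strictly above [T], hence the shift to [T + 1]. *)
have [|t Tt lt_t] := ret (1 - e) (T + 1); first by rewrite ltrBlDr ltrDl.
apply: (@le_trans _ _ (complex.Re `|evolution N t u v|)%:E).
  by rewrite -EFinB lee_fin -lecR nE ltW.
apply: ereal_sup_ubound; exists t => //.
by apply: VT; apply: lt_le_trans Tt; rewrite ltrDl.
Qed.

End Evolution.

(** * Choice of the potential at u and v *)

Section AvoidingRoots.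
Local Open Scope classical_set_scope.

(** The excluded values form a countable union of finite sets, whereas [[0, 1]] has Lebesgue measure
    1. *)
Lemma real_avoiding_roots (R : realType) (T : countType)
    (E : T -> {poly R[i]}) :
  (forall t, E t != 0) -> exists x : R, forall t, ~~ root (E t) x%:C.
Proof.
move=> E0; apply: contrapT => none.
have cover_all : [set: R] `<=` \bigcup_(t in setT) [set x | root (E t) x%:C].
  move=> x _; apply: contrapT => nx; apply: none; exists x => t.
  by apply/negP => rx; apply: nx; exists t.
have : countable `[0 : R, 1].
  apply: (sub_countable (subset_card_le
    (subset_trans (@subsetT _ _) cover_all))).
  apply: bigcup_countable => [|t _]; first exact: countableP.
  apply: finite_set_countable.
  have [rs rsE] := closed_field_poly_normal (E t).
  apply: (sub_finite_set (B := [set` [seq complex.Re z | z <- rs]])).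
    move=> x /=; rewrite rsE rootZ ?lead_coef_eq0 // root_prod_XsubC => xrs.
    by apply/mapP; exists x%:C.
  exact: finite_seq.
move/countable_lebesgue_measure0; rewrite lebesgue_measure_itv /= lte_fin ltr01.
by rewrite -EFinB subr0 => /eqP; rewrite eqe oner_eq0.
Qed.

End AvoidingRoots.

(** * Secular polynomials and a generic value of the potential *)

Section Secular.
Variable R : realType.
Implicit Types (L : seq R) (om : R -> R).

Lemma node_polyN L l :
  (node_poly (map -%R L)).[- l] = (-1) ^+ size L * (node_poly L).[l].
Proof.
elim: L => [|m L IH]; first by rewrite /node_poly !big_nil !hornerE.
rewrite /node_poly /= !big_cons !hornerM -/(node_poly _) -/(node_poly _) IH.
by rewrite !hornerE exprS /=; ring.
Qed.

Lemma others_rem L l : uniq L -> l \in L -> others L l = node_poly (rem l L).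
Proof. by move=> uL lL; rewrite /others -big_filter -rem_filter. Qed.

(** The products in [weight_poly] have one factor fewer than [node_poly]. Negating the weights
    restores the sign of [node_polyN], so reflected roots solve the reflected equation with the same
    [x]. *)
Lemma weight_polyN L om l : uniq L -> (0 < size L)%N ->
  (weight_poly (map -%R L) (fun m => - om (- m))).[- l] =
  (-1) ^+ size L * (weight_poly L om).[l].
Proof.
move=> uL L_gt0; rewrite /weight_poly big_map !horner_sum mulr_sumr.
apply: eq_big_seq => m mL; rewrite !hornerZ opprK (others_rem uL mL).
have -> : others (map -%R L) (- m) = node_poly (map -%R (rem m L)).
  rewrite /others /node_poly !big_map rem_filter // big_filter.
  by apply: eq_bigl => k; rewrite eqr_opp.
rewrite node_polyN size_rem // -[in RHS](prednK L_gt0) exprS; ring.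
Qed.

Section Kind.
Variables (L : seq R) (om : R -> R).
Hypotheses (uL : uniq L) (L_gt0 : (0 < size L)%N).
Hypothesis om_neq0 : {in L, forall l, om l != 0}.
Let F := map_poly (real_complex R) (node_poly L).
Let G := map_poly (real_complex R) (weight_poly L om).

Lemma node_poly_monic : F \is monic.
Proof. by rewrite map_monic monic_prod_XsubC. Qed.

Lemma size_node_poly : size F = (size L).+1.
Proof. by rewrite size_map_poly size_prod_XsubC. Qed.

Lemma size_others l : l \in L -> size (others L l) = size L.
Proof.
move=> lL; apply: succn_inj; rewrite -(size_prod_XsubC L id) -/(node_poly L).
rewrite (node_polyD1 uL lL).
rewrite size_monicM ?monicXsubC ?monic_neq0 ?monic_prod_XsubC //.
by rewrite size_XsubC.
Qed.

Lemma size_weight_poly : (size G < size F)%N.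
Proof.
rewrite size_node_poly size_map_poly ltnS.
rewrite /weight_poly big_seq; elim/big_ind: _ => [|p q sp sq|l lL].
- by rewrite size_poly0.
- by apply: leq_trans (size_polyD _ _) _; rewrite geq_max sp.
- by apply: leq_trans (size_scale_leq _ _) _; rewrite size_others.
Qed.

Lemma node_weight_coprime z : root F z -> ~~ root G z.
Proof.
rewrite /F /node_poly map_prod_XsubC.
rewrite -(big_map (real_complex R) predT (fun y => 'X - y%:P)) root_prod_XsubC.
move=> /mapP[l lL ->]; rewrite /root horner_map /= fmorph_eq0.
by rewrite weight_poly_node // mulf_neq0 ?others_neq0 ?om_neq0.
Qed.

(** Every [others L l] is monic of degree [size L - 1], so the coefficient of [weight_poly] in that
    degree is the total mass. *)
Lemma mean_root_node (x : R) :
  - (F - x%:C *: G)`_(size F).-2 / (size F).-1%:R =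
  ((\sum_(l <- L) l + x * \sum_(l <- L) om l) / (size L)%:R)%:C.
Proof.
rewrite size_node_poly /= coefB coefZ !coef_map /=.
have -> : (node_poly L)`_(size L).-1 = - \sum_(l <- L) l.
  by rewrite coefPn_prod_XsubC // -lt0n.
have -> : (weight_poly L om)`_(size L).-1 = \sum_(l <- L) om l.
  rewrite coef_sum; apply: eq_big_seq => l lL; rewrite coefZ.
  rewrite -(size_others lL) -lead_coefE.
  by rewrite (monicP (monic_prod_XsubC _ _ _)) mulr1.
rewrite -(rmorph_nat (real_complex R)).
rewrite -rmorphM -rmorphB -rmorphN -fmorphV -rmorphM.
by rewrite opprB addrC opprK.
Qed.

End Kind.

Lemma generic_parameter (L : bool -> seq R) (om : bool -> R -> R) :
  (forall b, uniq (L b)) -> (forall b, (0 < size (L b))%N) ->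
  (forall b, {in L b, forall l, om b l != 0}) ->
  (forall b, \sum_(l <- L b) om b l = 1) ->
  \sum_(l <- L true) l < \sum_(l <- L false) l ->
  exists x : R, forall a a' : seq (bool * R),
    {in a ++ a', forall j, (node_poly (L j.1)).[j.2] =
                           x * (weight_poly (L j.1) (om j.1)).[j.2]} ->
    size a = size a' -> \sum_(j <- a) j.2 = \sum_(j <- a') j.2 ->
    (\sum_(j <- a) j.1 = \sum_(j <- a') j.1)%N.
Proof.
move=> uL L_gt0 om0 om1 gap.
(* The kind (b, true) carries the opposites of the roots of kind (b, false),
   which turns equality of two sums of roots into a zero sum. *)
pose nd (k : bool * bool) := if k.2 then map -%R (L k.1) else L k.1.
pose wt (k : bool * bool) :=
  if k.2 then fun m => - om k.1 (- m) else om k.1.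
pose F k := map_poly (real_complex R) (node_poly (nd k)).
pose G k := map_poly (real_complex R) (weight_poly (nd k) (wt k)).
have uN k : uniq (nd k).
  by rewrite /nd; case: k.2; rewrite ?(map_inj_uniq oppr_inj).
have sN k : size (nd k) = size (L k.1).
  by rewrite /nd; case: k.2; rewrite ?size_map.
have N_gt0 k : (0 < size (nd k))%N by rewrite sN.
have w0 k : {in nd k, forall l, wt k l != 0}.
  case: k => b [] /=; rewrite /nd /wt /=; last exact: om0.
  by move=> _ /mapP[l lL ->]; rewrite opprK oppr_eq0 om0.
have meanE x k : mean_root F G x%:C k = ((-1) ^+ k.2 *
    ((\sum_(l <- L k.1) l + x) / (size (L k.1))%:R))%:C.
  rewrite /mean_root mean_root_node // sN; congr _%:C.
  case: k => b [] /=; rewrite /nd /wt /= ?om1 ?expr0 ?expr1; last by ring.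
  rewrite !big_map sumrN; under [X in x * X]eq_bigr do rewrite opprK.
  by rewrite sumrN om1; ring.
have F_gt1 k : (1 < size (F k))%N by rewrite size_node_poly ltnS.
have gen := generic_zero_sum (F := F) (G := G)
  (fun k => node_poly_monic (nd k)) F_gt1
  (fun k => size_weight_poly (wt k) (uN k))
  (fun k => node_weight_coprime (uN k) (@w0 k)).
have /choice[E EE] ks : exists E : {poly R[i]},
    E != 0 /\ forall x, ~~ root E x -> forall zs,
    all2 (fun k z => root (F k - x *: G k) z) ks zs ->
    \sum_(z <- zs) z = 0 -> \sum_(k <- ks) mean_root F G x k = 0.
  by have [E E0 EP] := gen ks; exists E; split.
pose kf : R := (size (L false))%:R; pose kt : R := (size (L true))%:R.
have kf0 : kf != 0 by rewrite pnatr_eq0 -lt0n.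
have kt0 : kt != 0 by rewrite pnatr_eq0 -lt0n.
(* At [x] this is [kf * kt] times the difference of the two means. It is nonzero: if [kf = kt] its
   constant term is not zero, by [gap]. *)
pose D : {poly R} := kf *: ('X + (\sum_(l <- L true) l)%:P) -
                     kt *: ('X + (\sum_(l <- L false) l)%:P).
have D0 : D != 0.
  apply: contraTneq gap => D0; rewrite -leNgt.
  have D1 : kf = kt.
    apply/eqP; rewrite -subr_eq0; apply/eqP.
    have := congr1 (fun p : {poly R} => p`_1) D0.
    by rewrite /D !(coefB, coefZ, coefD, coefX, coefC) /= !addr0 !mulr1.
  have := congr1 (fun p : {poly R} => p.[0]) D0.
  rewrite /D D1 !hornerE /= -mulrBr => /eqP.
  by rewrite mulf_eq0 (negPf kt0) subr_eq0 /= => /eqP ->.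
have DC0 : map_poly (real_complex R) D != 0 by rewrite map_poly_eq0.
(* One polynomial for each of the countably many words of kinds, and [None] for the coincidence of
   the means. *)
have [x nx] := @real_avoiding_roots R (option (seq (bool * bool)))
  (fun o => if o is Some ks then E ks else map_poly (real_complex R) D)
  (fun o => match o with Some ks => (EE ks).1 | None => DC0 end).
exists x => a a' Haa' saa' sumaa'.
pose M b := (\sum_(l <- L b) l + x) / (size (L b))%:R.
have Mneq : M true - M false != 0.
  have := nx None.
  rewrite /root horner_map fmorph_eq0 /D !hornerE /= /M -/kf -/kt.
  apply: contraNN => /eqP eqM; apply/eqP.
  transitivity (kf * kt * (M true - M false)); last by rewrite eqM mulr0.
  by rewrite /M -/kf -/kt; field; rewrite kf0.
pose c := [seq (j, false) | j <- a] ++ [seq (j, true) | j <- a'].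
pose ks := [seq (q.1.1, q.2) | q <- c].
pose zs := [seq ((-1) ^+ q.2 * q.1.2)%:C | q : (bool * R) * bool <- c].
have all2_c (r : bool * bool -> R[i] -> bool)
    (f : (bool * R) * bool -> bool * bool) g t :
    all (fun q => r (f q) (g q)) t -> all2 r (map f t) (map g t).
  by elim: t => //= q t IH /andP[-> /IH].
have sum_c (h : bool * R -> R) : \sum_(q <- c) (-1) ^+ q.2 * h q.1 =
    \sum_(j <- a) h j - \sum_(j <- a') h j.
  rewrite big_cat !big_map /= -sumrN; congr (_ + _); apply: eq_bigr => j _.
    by rewrite expr0 mul1r.
  by rewrite expr1 mulN1r.
have roots_c : all2 (fun k z => root (F k - x%:C *: G k) z) ks zs.
  apply: all2_c; apply/allP => -[[b l] e] qc /=.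
  have jaa' : (b, l) \in a ++ a'.
    move: qc; rewrite !mem_cat => /orP[] /mapP[j ja [-> _]];
    by rewrite ja ?orbT.
  have /= Hl := Haa' _ jaa'.
  rewrite /root hornerD hornerN hornerZ !horner_map -rmorphM -rmorphB /=.
  rewrite fmorph_eq0 subr_eq0 /nd /wt /=.
  case: (e); last by rewrite expr0 mul1r Hl.
  by rewrite expr1 mulN1r node_polyN weight_polyN // Hl mulrCA.
have sum_zs : \sum_(z <- zs) z = 0.
  rewrite /zs big_map -rmorph_sum /= (sum_c (fun j => j.2)) sumaa' subrr.
  by rewrite rmorph0.
have := (EE ks).2 _ (nx (Some ks)) zs roots_c sum_zs.
rewrite /ks big_map; under eq_bigr do rewrite meanE -/(M _) /=.
(* As both families have the same size, the vanishing sum of means is the difference of the two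
   counts of [true] times [M true - M false]. *)
rewrite -rmorph_sum /= (sum_c (fun j => M j.1)).
have sumM t : \sum_(j <- t) M j.1 =
    (size t)%:R * M false +
    (\sum_(j <- t) (j.1 : nat))%N%:R * (M true - M false).
  rewrite -sum1_size !natr_sum !mulr_suml -big_split /=.
  by apply: eq_bigr => -[[] l] _ /=; ring.
rewrite !sumM saa' => /eqP; rewrite fmorph_eq0 opprD addrACA subrr add0r.
by rewrite -mulrBl mulf_eq0 (negPf Mneq) orbF subr_eq0 eqr_nat => /eqP.
Qed.

End Secular.

(** * Pretty good state transfer *)

Section AdjacencyAmplitude.
Variables (R : realType) (n' : nat) (e : rel 'I_n'.+1).
Local Notation n := n'.+1.
Local Notation A := (adjacency R e).
Hypothesis simple : simple_graph e.

Lemma adjacency_sym : A^T = A.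
Proof. by apply/matrixP => i j; rewrite !mxE simple.1. Qed.

Lemma adjacency_ge0 i j : 0 <= A i j.
Proof. by rewrite mxE ler0n. Qed.

Lemma adjacency_le1 i j : `|A i j| <= 1.
Proof. by rewrite ger0_norm ?adjacency_ge0 // mxE lern1 leq_b1. Qed.

Lemma adjacency_diag i : A i i = 0.
Proof. by rewrite mxE simple.2. Qed.

Lemma adjacency_exp_ge0 k i j : 0 <= (A ^+ k) i j.
Proof.
elim: k i j => [|k IH] i j; first by rewrite expr0 mxE ler0n.
rewrite exprS -mulmxE mxE sumr_ge0 // => l _.
by rewrite mulr_ge0 ?adjacency_ge0.
Qed.

Lemma adjacency_exp_path x p :
  path e x p -> 0 < (A ^+ size p) x (last x p).
Proof.
elim: p x => [|z p IH] x /=; first by rewrite expr0 mxE eqxx ltr01.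
case/andP=> exz /IH pos; rewrite exprS -mulmxE mxE (bigD1 z) //=.
rewrite ltr_pwDl ?sumr_ge0 // => [|l _].
  by rewrite mxE exz mul1r.
by rewrite mulr_ge0 ?adjacency_ge0 ?adjacency_exp_ge0.
Qed.

Lemma mul_deltaE (M : 'M[R]_n) (x i : 'I_n) :
  (M *m (delta_mx x 0 : 'cV_n)) i 0 = M i x.
Proof. by rewrite -colE mxE. Qed.

(** A path from [w] to [u] contributes a positive term, which nonnegative entries cannot cancel. *)
Lemma adjacency_reach u v w : connected_graph e ->
  exists k, (A ^+ k *m sumv R u v) w 0 != 0.
Proof.
move=> conn; have /connectP[p ep ->] := conn w u.
exists (size p); rewrite /sumv mulmxDr mxE !mul_deltaE gt_eqF //.
by rewrite ltr_pwDl ?adjacency_exp_path ?adjacency_exp_ge0.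
Qed.

(** The boolean also serves as the exponent of the sign in [almost_return]. *)
Definition parity_vec u v (b : bool) : 'cV[R]_n :=
  if b then diffv R u v else sumv R u v.

Lemma dot_parity_vec u v b : u != v ->
  dot (parity_vec u v b) (parity_vec u v b) = 2.
Proof.
move=> uv; rewrite /parity_vec; case: b.
  by rewrite dot_diffv !mxE !eqxx (eq_sym v) (negPf uv) /=; ring.
by rewrite dot_sumv !mxE !eqxx (eq_sym v) (negPf uv) /=; ring.
Qed.

(** [e_u = (s + d) / 2] and [e_v = (s - d) / 2]; the mixed terms cancel by symmetry. *)
Lemma polarization (M : 'M[R]_n) u v : M^T = M ->
  M u v = (dot (parity_vec u v false) (M *m parity_vec u v false) -
           dot (parity_vec u v true) (M *m parity_vec u v true)) / 4.
Proof.
move=> symM; have Mvu : M v u = M u v by rewrite -[in LHS]symM mxE.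
rewrite /parity_vec dot_sumv dot_diffv /sumv /diffv mulmxDr mulmxBr.
rewrite ![(_ + _ : 'cV_n) _ _]mxE ![(- _ : 'cV_n) _ _]mxE !mul_deltaE Mvu.
by field.
Qed.

(** The index type is a disjoint union: a node common to both measures would occur twice, with
    opposite signs. *)
Lemma evolution_measures (N : 'M[R]_n) u v (L : bool -> seq R) om t :
  N^T = N ->
  (forall b, spectral_measure N (parity_vec u v b) (L b) (om b)) ->
  evolution N t u v = \sum_(j : {b : bool & 'I_(size (L b))})
    (-1) ^+ tag j * (om (tag j) (L (tag j))`_(tagged j) / 4)%:C *
      cis (t * (L (tag j))`_(tagged j)).
Proof.
move=> symN meas.
rewrite (@evolutionE R n' N u v t {b : bool & 'I_(size (L b))}
  (fun j => (-1) ^+ tag j * (om (tag j) (L (tag j))`_(tagged j) / 4))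
  (fun j => (L (tag j))`_(tagged j))).
  by apply: eq_bigr => j _; rewrite rmorphM rmorphXn rmorphN1.
move=> k; rewrite polarization; last first.
  by rewrite -[N in N ^+ k](horner_mx_X N) -rmorphXn tr_horner_mx.
have mom b : dot (parity_vec u v b) (N ^+ k *m parity_vec u v b) =
    \sum_(l <- L b) om b l * l ^+ k.
  have [_ _ _ m] := meas b; have := m 'X^k.
  rewrite rmorphXn /= horner_mx_X => ->.
  by apply: eq_bigr => l _; rewrite hornerXn.
rewrite !mom.
rewrite -(sig_big_dep (fun=> true) (fun _ _ => true)
  (fun b (i : 'I_(size (L b))) =>
  (-1) ^+ b * (om b (L b)`_i / 4) * (L b)`_i ^+ k)) /=.
have half b : \sum_(i < size (L b))
      (-1) ^+ b * (om b (L b)`_i / 4) * (L b)`_i ^+ k =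
    (-1) ^+ b * (\sum_(l <- L b) om b l * l ^+ k) / 4.
  rewrite (big_nth 0) big_mkord mulr_sumr mulr_suml.
  by apply: eq_bigr => i _; rewrite !mulrA mulrAC.
by rewrite big_bool !half /= expr0 expr1; field.
Qed.

End AdjacencyAmplitude.

Theorem corollary4p3 (R : realType) (n : nat) (e : rel 'I_n)
    (P : {set {set 'I_n}}) (u v w : 'I_n) :
  simple_graph e -> connected_graph e ->
  equitable_partition (adjacency R e) P ->
  u != v -> [set u; v]%SET \in P -> [set w]%SET \in P ->
  exists qu qv qw : R,
    pgst (adjacency R e + (potential qu u + potential qv v + potential qw w))
      u v.
Proof.
case: n e P u v w => [|n'] e P u v w; first by case: u.
move=> simple conn equit uv uvP wP.
pose A := adjacency R e; pose sb := parity_vec R u v.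
have symA : A^T = A by exact: adjacency_sym.
have [y y0 gap] := node_sum_gap symA (@adjacency_le1 R n' e)
  (@adjacency_diag R n' e simple) equit uv uvP wP
  (adjacency_reach R u v w conn).
have symB : (base A w y)^T = base A w y by exact: sym_base.
have /choice[L /choice[om meas]] b := spectral_measure_exists (sb b) symB.
have sum2 M l o b : spectral_measure M (sb b) l o -> \sum_(m <- l) o m = 2.
  case=> _ _ _ /(_ 1); rewrite rmorph1 mul1mx dot_parity_vec // => ->.
  by apply: eq_bigr => m _; rewrite hornerC mulr1.
(* Both vectors have squared norm 2, so the halved weights of the secular equation have mass 1. *)
have om1 b : \sum_(l <- L b) om b l / 2 = 1.
  by rewrite -mulr_suml (sum2 _ _ _ _ (meas b)) divff // pnatr_eq0.
have L_gt0 b : (0 < size (L b))%N.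
  case: (L b) (om1 b) => // /eqP.
  by rewrite big_nil eq_sym oner_eq0.
have [x nx] : exists x : R, forall a a' : seq (bool * R),
    {in a ++ a', forall j, (node_poly (L j.1)).[j.2] =
      x * (weight_poly (L j.1) (fun m => om j.1 m / 2)).[j.2]} ->
    size a = size a' -> \sum_(j <- a) j.2 = \sum_(j <- a') j.2 ->
    (\sum_(j <- a) j.1 = \sum_(j <- a') j.1)%N.
  apply: (@generic_parameter R L (fun b m => om b m / 2)) => // [b|b l lL|].
  - by have [] := meas b.
  - have [_ _ om0 _] := meas b.
    by rewrite mulf_neq0 ?invr_eq0 ?pnatr_eq0 // gt_eqF ?om0.
  - exact: (gap _ _ _ _ (meas false) (meas true)).
exists x, x, y.
set N := _ + _.
have NE : N = base A w y + (potential x u + potential x v).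
  by rewrite /N /base -[RHS]addrA [X in _ = _ + X]addrC.
have symN : N^T = N.
  by rewrite NE linearD /= symB /potential linearD /= !linearZ /= !trmx_delta.
have /choice[Lx /choice[omx measx]] b := spectral_measure_exists (sb b) symN.
(* The value [x] was fixed using the measures of [base] alone; the nodes of [N] now turn out to be
   roots of those secular polynomials. *)
have secular b l : l \in Lx b ->
  (node_poly (L b)).[l] = x * (weight_poly (L b) (fun m => om b m / 2)).[l].
  move=> lL; have [eig sh] := spectral_eigenvector symN (measx b) lL.
  rewrite NE in eig sh.
  apply: (secular_equation (d := sb (~~ b)) symB (meas b) _ _ eig sh).
    move=> p; case: b {lL eig sh}; rewrite /sb /parity_vec /=.
      exact: (cross_ds symA equit uv uvP wP).
    exact: (cross_sd symA equit uv uvP wP).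
  move=> g; rewrite potential_pairE.
  by case: b {lL eig sh}; rewrite /sb /parity_vec //= addrC.
have evE t := evolution_measures t symN measx.
have mem_Lx (j : {b : bool & 'I_(size (Lx b))}) :
  (Lx (tag j))`_(tagged j) \in Lx (tag j) by exact: mem_nth.
have pos (j : {b : bool & 'I_(size (Lx b))}) :
  0 < omx (tag j) (Lx (tag j))`_(tagged j) / 4.
  have [_ _ om0 _] := measx (tag j).
  by rewrite divr_gt0 // om0.
have tot : \sum_(j : {b : bool & 'I_(size (Lx b))})
    omx (tag j) (Lx (tag j))`_(tagged j) / 4 = 1.
  rewrite -(sig_big_dep (fun=> true) (fun _ _ => true)
    (fun b (i : 'I_(size (Lx b))) => omx b (Lx b)`_i / 4)) /= big_bool /=.
  have half b : \sum_(i < size (Lx b)) omx b (Lx b)`_i / 4 = 1 / 2.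
    have -> : 1 / 2 = (\sum_(l <- Lx b) omx b l) / 4 :> R.
      by rewrite (sum2 _ _ _ _ (measx b)); field.
    by rewrite -mulr_suml (big_nth 0) big_mkord.
  by rewrite !half; field.
apply: pgstP => [t|rho T rho1].
  rewrite evE; apply: le_trans (ler_norm_sum _ _ _) _.
  rewrite -[leRHS]/((1 : R)%:C) -[X in _ <= X%:C]tot rmorph_sum /=.
  apply: ler_sum => j _.
  rewrite !normrM normrX normrN1 expr1n mul1r norm_cis mulr1.
  by rewrite ger0_norm // ler0c ltW.
(* The genericity of [x] supplies the sign condition of Bohr's argument. *)
have indep (a a' : seq {b : bool & 'I_(size (Lx b))}) : size a = size a' ->
  \sum_(j <- a) (Lx (tag j))`_(tagged j) =
    \sum_(j <- a') (Lx (tag j))`_(tagged j) ->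
  (\sum_(j <- a) tag j = \sum_(j <- a') tag j)%N.
  move=> saa' sumaa'.
  pose f (j : {b : bool & 'I_(size (Lx b))}) :=
    (tag j, (Lx (tag j))`_(tagged j)).
  have := nx (map f a) (map f a'); rewrite !size_map !big_map /=; apply => //.
  by move=> q; rewrite -map_cat => /mapP[j _ ->]; exact/secular/mem_Lx.
have [t tT Ht] := almost_return pos tot indep T rho1.
by exists t; rewrite // evE.
Qed.
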